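(* Let $G=(S,A,\Gamma_1,\Gamma_2,\delta)$ be a concurrent game structure with a boolean reward function $r$, and let $Y^*=\mu Y.\,\nu Z.\,\mathrm{ASP}(S,Y,Z)$. Then: 1. $$Y^*=\mathsf{Positive}_1(\mathsf{LimInfAvg}(1))=\mathsf{Positive}_1(\mathsf{LimSupAvg}(1))=\bigcap_{\varepsilon>0}\mathsf{Positive}_1(\mathsf{LimInfAvg}(1-\varepsilon))=\bigcap_{\varepsilon>0}\mathsf{Positive}_1(\mathsf{LimSupAvg}(1-\varepsilon)),$$ and $$S\setminus Y^*=\mathsf{Almost}_2(\overline{\mathsf{LimInfAvg}}(1))=\mathsf{Almost}_2(\overline{\mathsf{LimSupAvg}}(1))=\bigcup_{c>0}\mathsf{Almost}_2(\overline{\mathsf{LimInfAvg}}(1-c))=\bigcup_{c>0}\mathsf{Almost}_2(\overline{\mathsf{LimSupAvg}}(1-c)).$$ 2. The set $Y^*$ can be computed in quadratic time, namely in time $O(n\cdot|\delta|)$, by straightforward computation of the $\mu$-calculus formula $\mu Y.\,\nu Z.\,\mathrm{ASP}(S,Y,Z)$, where $n=|S|$ and $|\delta|=\sum_{s\in S}\sum_{a\in\Gamma_1(s)}\sum_{b\in\Gamma_2(s)}|\mathrm{Succ}(s,a,b)|$.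
   Context: A concurrent (two-player stochastic) game structure $G=(S,A,\Gamma_1,\Gamma_2,\delta)$ consists of a finite set $S$ of states, a finite set $A$ of actions, maps $\Gamma_1,\Gamma_2:S\to 2^A\setminus\{\emptyset\}$ ($\Gamma_i(s)$ is the set of actions available to player $i$ at $s$), and a transition function $\delta$ assigning to each $s\in S$, $a_1\in\Gamma_1(s)$, $a_2\in\Gamma_2(s)$ a probability distribution $\delta(s,a_1,a_2)$ on $S$. $\mathrm{Succ}(s,a_1,a_2)$ is the support of $\delta(s,a_1,a_2)$. In every round both players simultaneously and independently choose available actions, and the successor state is drawn from $\delta$. A play is an infinite sequence $\omega=((s_0,a_1^0,a_2^0),(s_1,a_1^1,a_2^1),\dots)$ of states and action pairs consistent with $\Gamma_1,\Gamma_2$ and $\mathrm{Succ}$. A strategy for player $i$ maps every history in $(S\times A\times A)^*\times S$ to a probability distribution on the available actions $\Gamma_i(s)$ of its last state $s$. $\Pr_s^{\sigma_1,\sigma_2}$ is the induced probability measure on plays starting in $s$. A boolean reward function is $r:S\times A\times A\to\{0,1\}$. $\mathsf{LimInfAvg}(\omega)=\liminf_{N\to\infty}\frac1N\sum_{i=0}^{N-1}r(s_i,a_1^i,a_2^i)$, and $\mathsf{LimSupAvg}(\omega)$ is the same with $\limsup$. For $\mathsf{L}\in\{\mathsf{LimInfAvg},\mathsf{LimSupAvg}\}$ and real $\lambda$: $\mathsf{L}(\lambda)=\{\omega\mid\mathsf{L}(\omega)\ge\lambda\}$, $\overline{\mathsf{L}}(\lambda)=\{\omega\mid\mathsf{L}(\omega)<\lambda\}$.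 For a measurable set $\Phi$ of plays, $\mathsf{Positive}_1(\Phi)=\{s\mid\exists\sigma_1\forall\sigma_2:\Pr_s^{\sigma_1,\sigma_2}(\Phi)>0\}$ and $\mathsf{Almost}_2(\Phi)=\{s\mid\exists\sigma_2\forall\sigma_1:\Pr_s^{\sigma_1,\sigma_2}(\Phi)=1\}$. For $X,Y,Z\subseteq S$ define $\mathrm{Allow}_1(s,X)=\{a_1\in\Gamma_1(s)\mid\forall a_2\in\Gamma_2(s):\mathrm{Succ}(s,a_1,a_2)\subseteq X\}$; $\mathrm{Bad}_2(s,X,Y)=\{a_2\in\Gamma_2(s)\mid\exists a_1\in\mathrm{Allow}_1(s,X):\mathrm{Succ}(s,a_1,a_2)\cap Y\ne\emptyset\}$; $\mathrm{Good}_1(s,X,Y,Z)=\{a_1\in\mathrm{Allow}_1(s,X)\mid\forall a_2\in\Gamma_2(s)\setminus\mathrm{Bad}_2(s,X,Y):\mathrm{Succ}(s,a_1,a_2)\subseteq Z\text{ and }r(s,a_1,a_2)=1\}$; $\mathrm{ASP}(X,Y,Z)=\{s\in S\mid\mathrm{Good}_1(s,X,Y,Z)\ne\emptyset\}$. $\mathrm{ASP}$ is monotone in each argument; $\mu$ and $\nu$ denote least and greatest fixpoints in the lattice $2^S$. *)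

(* Defs.v *)
From HB Require Import structures.
From mathcomp Require Import all_boot all_order all_algebra.
From mathcomp Require Import all_classical all_reals all_analysis.

Set Implicit Arguments.
Unset Strict Implicit.
Unset Printing Implicit Defensive.

Import Order.TTheory GRing.Theory Num.Theory.
Import numFieldNormedType.Exports.

Local Open Scope classical_set_scope.
Local Open Scope ring_scope.

(* [t0] only provides the point that [measurableType] requires. *)
Definition infseq (T : Type) (t0 : T) : Type := nat -> T.

Section InfSeq.
Variables (T : Type) (t0 : T).

HB.instance Definition _ := gen_eqMixin (infseq t0).
HB.instance Definition _ := gen_choiceMixin (infseq t0).
HB.instance Definition _ := isPointed.Build (infseq t0) (fun=> t0).

Definition cylinder (h : seq T) : set (infseq t0) :=
  [set w | mkseq w (size h) = h].

End InfSeq.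

Arguments cylinder {T} t0 h.

Notation infseq_meas t0 := (g_sigma_algebraType (range (cylinder t0))).

Section Uniqueness.
Variables (R : realType) (T : Type) (t0 : T).

Lemma infseq_prob_unique (P Q : probability (infseq_meas t0) R) :
  (forall h, P (cylinder t0 h) = Q (cylinder t0 h)) ->
  forall A, measurable A -> P A = Q A.
Proof.
move=> PQ; pose G := range (cylinder t0) `|` [set set0].
have mG : G `<=` @measurable _ (infseq_meas t0).
  by move=> A [Gc|->] //; exact: sub_sigma_algebra.
have prefix_le (w : nat -> T) m n : (m <= n)%N -> mkseq w m = take m (mkseq w n).
  by move=> mn; rewrite /mkseq -map_take take_iota (minn_idPl mn).
have GI : setI_closed G.
  have GI' h k : (size h <= size k)%N ->
      G (cylinder t0 h `&` cylinder t0 k).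
    move=> hk; have [e|ne] := pselect (take (size h) k = h).
      left; exists k => //; apply/seteqP; split => [w wk|w [//]]; split => //.
      rewrite /cylinder /= (prefix_le w _ _ hk).
      by move: wk; rewrite /cylinder /= => ->.
    right; apply/seteqP; split => // w [] wh wk; apply: ne.
    by move: wh; rewrite /cylinder /= (prefix_le w _ _ hk) wk.
  move=> _ _ [[h _ <-]|->] [[k _ <-]|->]; rewrite ?setI0 ?set0I; try by right.
  by case: (leqP (size h) (size k)) => [|/ltnW] /GI' //; rewrite setIC.
apply: (@measure_unique _ R (infseq_meas t0) G (fun=> setT) _ GI _ _ P Q) => //.
- apply/seteqP; split => A; last first.
    by apply: smallest_sub; [exact: sigma_algebra_measurable|].
  apply: smallest_sub; first exact: smallest_sigma_algebra.
  by move=> B GB; apply: sub_sigma_algebra; left.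
- by move=> _; left; exists [::] => //; apply/seteqP; split.
- by apply/seteqP; split => // w _; exists 0%N.
- by move=> _ [[h _ <-]|->]; [exact: PQ|rewrite !measure0].
- by move=> _; rewrite -ge0_fin_numE // fin_num_measure.
Qed.

End Uniqueness.

Section Construction.
Variables (R : realType) (T : finType) (t0 : T) (p : seq T -> R).
Hypothesis p0 : p [::] = 1.
Hypothesis p_ge0 : forall h, 0 <= p h.
Hypothesis p_sum : forall h, \sum_t p (rcons h t) = p h.

(* The sequence is read off a uniform point of [0, 1[: nested intervals of
   length [p h] are assigned to the words [h]. Words are reversed in this
   section. *)
Let q (g : seq T) := p (rev g).
Let qsum g : \sum_t q (t :: g) = q g.
Proof.
by rewrite /q -p_sum; apply: eq_bigr => t _; rewrite rev_cons.
Qed.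

Let q_ge0 g : 0 <= q g. Proof. exact: p_ge0. Qed.

Let csum g k := \sum_(t' | (enum_rank t' < k)%N) q (t' :: g).

Let csum_ge0 g k : 0 <= csum g k.
Proof. by apply: sumr_ge0. Qed.

Let csumS g t : csum g (enum_rank t).+1 = csum g (enum_rank t) + q (t :: g).
Proof.
rewrite /csum (bigD1 t) //= addrC; congr (_ + _).
apply: eq_bigl => t'; rewrite ltnS leq_eqVlt.
have [->|ne] := eqVneq t' t; first by rewrite eqxx ltnn.
rewrite andbT; case: eqP => //= /val_inj/enum_rank_inj e.
by rewrite e eqxx in ne.
Qed.

Let csum_mono g k l : (k <= l)%N -> csum g k <= csum g l.
Proof.
move=> kl; rewrite /csum [leRHS]big_mkcond [leLHS]big_mkcond.
apply: ler_sum => t _; case: ltnP => // tk.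
  by rewrite (leq_trans tk kl).
by case: ifP.
Qed.

Let csum_full g : csum g #|T| = q g.
Proof.
rewrite -qsum /csum; apply: eq_bigl => t; exact: ltn_ord.
Qed.

Let csum0 g : csum g 0 = 0.
Proof. by rewrite /csum big_pred0. Qed.

Let Fixpoint left_end (g : seq T) : R :=
  if g is t :: g' then left_end g' + csum g' (enum_rank t) else 0.

Let I (g : seq T) : set R := `[left_end g, left_end g + q g[%classic.

Let inI g u : I g u <-> (left_end g <= u /\ u < left_end g + q g).
Proof.
by rewrite /I /= in_itv /=; split=> [/andP[]//|[-> ->]].
Qed.

Let right_endE t g : left_end (t :: g) + q (t :: g) =
  left_end g + csum g (enum_rank t).+1.
Proof. by rewrite csumS addrA. Qed.

Let inIS t g u : I (t :: g) u <-> (left_end g + csum g (enum_rank t) <= u /\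
  u < left_end g + csum g (enum_rank t).+1).
Proof. by rewrite -right_endE; exact: inI. Qed.

Let le_csum g k l u v : (k <= l)%N -> left_end g + csum g l <= u ->
  v < left_end g + csum g k -> v < u.
Proof.
move=> kl lu vk; apply: lt_le_trans vk (le_trans _ lu).
by rewrite lerD2l; exact: csum_mono.
Qed.

Let I_sub t g u : I (t :: g) u -> I g u.
Proof.
move=> /inIS[h1 h2]; apply/inI; split.
  by apply: le_trans h1; rewrite lerDl.
apply: lt_le_trans h2 _; rewrite lerD2l -[leRHS]csum_full.
by apply: csum_mono; exact: ltn_ord.
Qed.

Let I_uniq t t' g u : I (t :: g) u -> I (t' :: g) u -> t = t'.
Proof.
move=> /inIS[h1 h2] /inIS[h3 h4].
apply: enum_rank_inj; apply: val_inj => /=.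
case: (ltngtP (enum_rank t) (enum_rank t')) => // lt.
- by have := le_csum lt h3 h2; rewrite ltxx.
- by have := le_csum lt h1 h4; rewrite ltxx.
Qed.

Let I_ex g u : I g u -> exists t, I (t :: g) u.
Proof.
move=> /inI[h1 h2].
have ex : exists k, u < left_end g + csum g k by exists #|T|; rewrite csum_full.
case: (ex_minnP ex) => [] [|k] hk kmin.
  by move: hk; rewrite csum0 addr0 ltNge h1.
have kT : (k < #|T|)%N by apply: kmin; rewrite csum_full.
exists (enum_val (Ordinal kT)); apply/inIS; rewrite enum_valK /=; split => //.
rewrite leNgt; apply/negP => /kmin.
by rewrite ltnn.
Qed.

Let Fixpoint prefix (u : R) n : seq T :=
  if n is k.+1 then
    let g := prefix u k in
    xget t0 [set t | I (t :: g) u] :: g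
  else [::].

Let X (u : R) : infseq_meas t0 := fun n => head t0 (prefix u n.+1).

Let size_prefix u n : size (prefix u n) = n.
Proof. by elim: n => //= n ->. Qed.

Let prefixE u n : rev (prefix u n) = mkseq (X u) n.
Proof.
elim: n => // n IH.
by rewrite mkseqS -IH -[prefix u n.+1]/(X u n :: prefix u n) rev_cons.
Qed.

Let I0 u : I [::] u <-> `[0, 1[%classic u.
Proof. by rewrite /I /= add0r /q /= p0. Qed.

Let prefixI u n : I [::] u -> I (prefix u n) u.
Proof.
move=> u01; elim: n => // n IH /=.
by have [t It] := I_ex IH; case: xgetP => [t' _ //|/(_ t)].
Qed.

Let I_take g g' u : I (g ++ g') u -> I g' u.
Proof. by elim: g => //= t g IH /I_sub. Qed.

Let prefix_eq g u : I g u -> prefix u (size g) = g.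
Proof.
elim: g => //= t g IH It; rewrite (IH (I_sub It)); congr (_ :: _).
by case: xgetP => [t' _ /I_uniq|/(_ t)//]; exact.
Qed.

Let X_cyl h (u : R) : `[0, 1[%classic u -> (cylinder t0 h (X u) <-> I (rev h) u).
Proof.
move=> /I0 u01; rewrite /cylinder /= -prefixE; split.
  by move=> e; rewrite -e revK; exact: prefixI.
by move=> /prefix_eq; rewrite size_rev => ->; rewrite revK.
Qed.

Let Ro : measurableType _ := measurableTypeR R.

Let Xr (u : Ro) : infseq_meas t0 := if 0 <= u < 1 then X u else (fun=> t0).

Let mXr : measurable_fun [set: Ro] Xr.
Proof.
apply: (@measurability _ _ Ro (infseq_meas t0) setT Xr (range (cylinder t0)) erefl).
move=> _ [_ [h _ <-] <-]; rewrite setTI.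
have -> : Xr @^-1` cylinder t0 h =
    (`[0, 1[ `&` I (rev h)) `|`
    (~` `[0, 1[ `&` [set _ | cylinder t0 h (fun=> t0)]).
  apply/seteqP; split => u; rewrite -[Xr]/(fun u => _) /Xr.
    rewrite [X in X -> _]/preimage /mkset; case: ifPn => u01 c.
      by left; split; [rewrite in_itv|apply/X_cyl => //; rewrite /= in_itv].
    by right; split=> //; rewrite /setC /mkset in_itv; exact/negP.
  case=> [[]|[]]; rewrite /setC /preimage /mkset in_itv /=.
    by move=> u01 /X_cyl; rewrite u01; apply; rewrite /= in_itv.
  by move=> /negP/negbTE ->.
apply: measurableU; apply: measurableI.
- exact: measurable_itv.
- exact: measurable_itv.
- by apply: measurableC; exact: measurable_itv.
- have [c|c] := pselect (cylinder t0 h (fun=> t0)).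
    by rewrite (_ : [set _ | _] = setT) //; apply/seteqP; split.
  by rewrite (_ : [set _ | _] = set0) //; apply/seteqP; split.
Qed.

Let I_measure g : lebesgue_measure (I g) = (q g)%:E.
Proof.
rewrite /I lebesgue_measure_itv /= lte_fin ltrDl.
case: ltP => [_|]; first by rewrite -EFinB addrAC subrr add0r.
by move=> q0; congr (_%:E); apply/eqP; rewrite eq_le q_ge0.
Qed.

Lemma infseq_prob_exists :
  exists P : probability (infseq_meas t0) R,
    forall h, P (cylinder t0 h) = (p h)%:E.
Proof.
pose X' : {mfun Ro >-> infseq_meas t0} :=
  HB.pack Xr (isMeasurableFun.Build _ _ _ _ Xr mXr).
have mD : measurable (`[0, 1[%classic : set Ro) by exact: measurable_itv.
pose U0 : {measure set Ro -> \bar R} := mrestr lebesgue_measure mD.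
have U01 : U0 setT = 1%E.
  rewrite /U0 /= /mrestr setTI lebesgue_measure_itv /= lte_fin ltr01.
  by rewrite -EFinB subr0.
pose U : probability Ro R :=
  HB.pack (U0 : set Ro -> \bar R) U0 (Measure_isProbability.Build _ _ _ U0 U01).
exists (distribution U X') => h.
rewrite -[h in RHS]revK -[p (rev (rev h))]/(q (rev h)) -I_measure.
rewrite -[LHS]/(lebesgue_measure (Xr @^-1` cylinder t0 h `&` `[0, 1[)).
have IE u : I (rev h) u -> `[0, 1[%classic u.
  by rewrite -[rev h]cats0 => /I_take/I0.
congr (lebesgue_measure _); apply/seteqP; split => u.
  move=> [hX u01]; apply/X_cyl => //.
  by move: u01 hX; rewrite /preimage /mkset /Xr in_itv /= => ->.
move=> Iu; have u01 := IE _ Iu; split => //.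
rewrite /preimage /mkset /Xr; move: (u01); rewrite /= in_itv /= => ->.
exact/X_cyl.
Qed.

End Construction.

Definition is_dist (R : realType) (T : finType) (p : T -> R) : Prop :=
  (forall x, 0 <= p x) /\ \sum_x p x = 1.

(* [delta] is constrained only at available actions. *)
Record game (R : realType) (S A : finType) := Game {
  avail1 : S -> {set A};
  avail2 : S -> {set A};
  delta : S -> A -> A -> S -> R;
  avail1_ex : forall s, exists a, a \in avail1 s;
  avail2_ex : forall s, exists b, b \in avail2 s;
  delta_dist : forall s a b, a \in avail1 s -> b \in avail2 s ->
    is_dist (delta s a b) }.

(* A round is a state with the actions chosen there by players 1 and 2; a
   history is a sequence of rounds followed by the current state. *)
Notation round S A := (S * A * A)%type.

Record strategy (R : realType) (S A : finType) (avail : S -> {set A}) :=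
  Strategy {
    choice_prob :> seq (round S A) -> S -> A -> R;
    choice_dist : forall h s, is_dist (choice_prob h s);
    choice_avail : forall h s a, a \notin avail s -> choice_prob h s a = 0 }.

Definition strategy1 R S A (G : game R S A) := strategy R (avail1 G).
Definition strategy2 R S A (G : game R S A) := strategy R (avail2 G).

Section Plays.
Variables (R : realType) (S A : finType) (G : game R S A).

Definition Succ (s : S) (a b : A) : {set S} := [set t | 0 < delta G s a b t]%SET.

(* Histories and sample sequences range over all rounds; the sequences
   consistent with the game are singled out here. *)
Definition is_play (w : nat -> round S A) : Prop :=
  forall i, let: (s, a, b) := w i in
    [/\ a \in avail1 G s, b \in avail2 G s & (w i.+1).1.1 \in Succ s a b].

Section Measure.
Variables (s0 : S) (sigma1 : strategy1 G) (sigma2 : strategy2 G).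

Definition state_prob (h : seq (round S A)) (s : S) : R :=
  match rev h with
  | [::] => (s == s0)%:R
  | (s', a, b) :: _ => delta G s' a b s
  end.

Definition round_prob (h : seq (round S A)) (x : round S A) : R :=
  let: (s, a, b) := x in state_prob h s * sigma1 h s a * sigma2 h s b.

Definition cylinder_prob (h : seq (round S A)) : R :=
  \prod_(i < size h) round_prob (take i h) (tnth (in_tuple h) i).

Lemma cylinder_prob_rcons h x :
  cylinder_prob (rcons h x) = cylinder_prob h * round_prob h x.
Proof.
have E k : cylinder_prob k =
    \prod_(0 <= i < size k) round_prob (take i k) (nth x k i).
  rewrite big_mkord /cylinder_prob; apply: eq_bigr => i _.
  by rewrite (tnth_nth x).
rewrite !E size_rcons big_nat_recr //= nth_rcons ltnn eqxx.
rewrite -cats1 take_size_cat //; congr (_ * _).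
apply: eq_big_nat => i /andP[_ ih].
by rewrite take_cat nth_cat ih.
Qed.

Let cylinder_prob0 : cylinder_prob [::] = 1.
Proof. by rewrite /cylinder_prob big_ord0. Qed.

Let state_dist h : cylinder_prob h != 0 -> is_dist (state_prob h).
Proof.
case/lastP: h => [_|h [[s a] b]].
  rewrite /state_prob /=; split=> [s|]; first exact: ler0n.
  rewrite (bigD1 s0) //= eqxx big1 ?addr0 // => s /negbTE ->.
  by [].
rewrite cylinder_prob_rcons !mulf_eq0 !negb_or -!andbA => /and4P[_ _ h1 h2].
have E : state_prob (rcons h (s, a, b)) = delta G s a b.
  by apply/funext => t; rewrite /state_prob rev_rcons.
rewrite E; apply: delta_dist.
  by apply: contraNT h1 => /choice_avail ->.
by apply: contraNT h2 => /choice_avail ->.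
Qed.

Let cylinder_prob_ge0 h : 0 <= cylinder_prob h.
Proof.
elim/last_ind: h => [|h [[s a] b] IH]; first by rewrite cylinder_prob0.
rewrite cylinder_prob_rcons.
have [->|/state_dist[p0 _]] := eqVneq (cylinder_prob h) 0; first by rewrite mul0r.
rewrite mulr_ge0 // /round_prob !mulr_ge0 //.
  by case: (choice_dist sigma1 h s).
by case: (choice_dist sigma2 h s).
Qed.

Let cylinder_prob_sum h :
  \sum_x cylinder_prob (rcons h x) = cylinder_prob h.
Proof.
under eq_bigr do rewrite cylinder_prob_rcons.
rewrite -mulr_sumr.
have [->|/state_dist[_ p1]] := eqVneq (cylinder_prob h) 0; first by rewrite mul0r.
rewrite -[RHS]mulr1; congr (_ * _).
transitivity (\sum_s \sum_a \sum_b round_prob h (s, a, b)).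
  by rewrite !pair_bigA; apply: eq_bigr => -[[]].
rewrite -p1; apply: eq_bigr => s _ /=.
have [_ q1] := choice_dist sigma1 h s; have [_ q2] := choice_dist sigma2 h s.
under eq_bigr do rewrite -mulr_sumr q2 mulr1.
by rewrite -mulr_sumr q1 mulr1.
Qed.

Definition round0 : round S A :=
  (s0, xchoose (avail1_ex G s0), xchoose (avail2_ex G s0)).

(* By [infseq_prob_unique], the measure on plays is determined by the
   probabilities of the cylinders. *)
Definition play_prob : probability (infseq_meas round0) R :=
  projT1 (cid (infseq_prob_exists round0
    cylinder_prob0 cylinder_prob_ge0 cylinder_prob_sum)).

Lemma play_probE h : play_prob (cylinder round0 h) = (cylinder_prob h)%:E.
Proof. exact: (projT2 (cid (infseq_prob_exists round0 _ _ _))). Qed.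

End Measure.

Definition Positive1 (Phi : set (nat -> round S A)) : set S :=
  [set s | exists sigma1 : strategy1 G, forall sigma2 : strategy2 G,
     (0 < play_prob s sigma1 sigma2 Phi)%E].

Definition Almost2 (Phi : set (nat -> round S A)) : set S :=
  [set s | exists sigma2 : strategy2 G, forall sigma1 : strategy1 G,
     play_prob s sigma1 sigma2 Phi = 1%E].

Variable r : S -> A -> A -> bool.

(* The term of index 0, which is 0, does not affect the limits. *)
Definition avg_reward (w : nat -> round S A) (N : nat) : R :=
  (\sum_(i < N) (let: (s, a, b) := w i in (r s a b)%:R)) / N%:R.

Definition LimInfAvg (w : nat -> round S A) : R := limn_inf (avg_reward w).
Definition LimSupAvg (w : nat -> round S A) : R := limn_sup (avg_reward w).

Definition at_least (L : (nat -> round S A) -> R) (lambda : R) :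
    set (nat -> round S A) :=
  [set w | is_play w /\ lambda <= L w].

Definition less_than (L : (nat -> round S A) -> R) (lambda : R) :
    set (nat -> round S A) :=
  [set w | is_play w /\ L w < lambda].

Definition Allow1 (s : S) (X : {set S}) : {set A} :=
  [set a in avail1 G s | [forall b in avail2 G s, Succ s a b \subset X]]%SET.

Definition Bad2 (s : S) (X Y : {set S}) : {set A} :=
  [set b in avail2 G s |
     [exists a in Allow1 s X, Succ s a b :&: Y != finset.set0]]%SET.

Definition Good1 (s : S) (X Y Z : {set S}) : {set A} :=
  [set a in Allow1 s X | [forall b in avail2 G s :\: Bad2 s X Y,
     (Succ s a b \subset Z) && r s a b]]%SET.

Definition ASP (X Y Z : {set S}) : {set S} :=
  [set s | Good1 s X Y Z != finset.set0]%SET.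

Lemma ASP_mono (X X' Y Y' Z Z' : {set S}) :
  X \subset X' -> Y \subset Y' -> Z \subset Z' -> ASP X Y Z \subset ASP X' Y' Z'.
Proof.
move=> /fintype.subsetP XX' /fintype.subsetP YY' ZZ'.
have allowS s a : a \in Allow1 s X -> a \in Allow1 s X'.
  rewrite !inE => /andP[-> /forall_inP h]; apply/forall_inP => b /h.
  by move=> /fintype.subsetP h'; apply/fintype.subsetP => t /h'/XX'.
have badS s b : b \in Bad2 s X Y -> b \in Bad2 s X' Y'.
  rewrite !inE => /andP[-> /exists_inP[a aX /set0Pn[t]]].
  rewrite inE => /andP[t1 t2]; apply/exists_inP; exists a; first exact: allowS.
  by apply/set0Pn; exists t; rewrite inE t1 YY'.
apply/fintype.subsetP => s; rewrite !inE => /set0Pn[a].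
rewrite inE => /andP[aX /forall_inP h]; apply/set0Pn; exists a.
rewrite inE allowS //=; apply/forall_inP => b.
rewrite inE => /andP[bX' bG]; have /h/andP[h1 ->] : b \in avail2 G s :\: Bad2 s X Y.
  by rewrite inE bG andbT; apply: contra bX' => /badS.
by rewrite (fintype.subset_trans h1).
Qed.

(* [cofixset] and [fixset] are the greatest and least fixpoints of monotone
   maps, by [ASP_mono] and [nuZ_mono]. *)
Definition nuZ (Y : {set S}) : {set S} :=
  cofixset (fun Z => ASP [set: S]%SET Y Z).

Lemma nuZ_mono (Y Y' : {set S}) : Y \subset Y' -> nuZ Y \subset nuZ Y'.
Proof.
move=> YY'; pose F U Z := ASP [set: S]%SET U Z.
have step (Z Z' : {set S}) :
    Z \subset Z' -> funsetC (F Y') Z \subset funsetC (F Y) Z'.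
  move=> ZZ'; rewrite finset.setCS; apply: ASP_mono => //.
  by rewrite finset.setCS.
rewrite /nuZ /cofixset finset.setCS /fixset.
elim: #|S| => [|k IH]; first exact: finset.sub0set.
exact: step IH.
Qed.

Definition Ystar : {set S} := fixset nuZ.

Definition delta_size : nat :=
  (\sum_(s : S) \sum_(a in avail1 G s) \sum_(b in avail2 G s) #|Succ s a b|)%N.

End Plays.

(* A unit-cost random access machine with a structured instruction set. Apart
   from constants of the program, words are only copied, compared, incremented
   and decremented, so that their size stays logarithmic in the largest input
   word plus the running time. Registers and arrays are named by the numerals
   of the program; each array has infinitely many cells. *)
Inductive expr :=
  | Cst of nat
  | Reg of nat
  | Get of nat & expr
  | Inc of expr
  | Dec of expr.

Inductive test :=
  | TestLt of expr & expr
  | TestEq of expr & expr.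

Inductive cmd :=
  | Skip
  | Assign of nat & expr
  | Put of nat & expr & expr
  | Seq of cmd & cmd
  | If of test & cmd & cmd
  | While of test & cmd
  | Loop of expr & cmd.

Record memory := Memory { reg : nat -> nat; arr : nat -> nat -> nat }.

Fixpoint eval (m : memory) (e : expr) : nat :=
  match e with
  | Cst n => n
  | Reg x => reg m x
  | Get a e => arr m a (eval m e)
  | Inc e => (eval m e).+1
  | Dec e => (eval m e).-1
  end.

Definition holds (m : memory) (b : test) : bool :=
  match b with
  | TestLt e f => (eval m e < eval m f)%N
  | TestEq e f => eval m e == eval m f
  end.

Definition set_reg (m : memory) (x v : nat) : memory :=
  Memory (fun y => if y == x then v else reg m y) (arr m).

Definition set_arr (m : memory) (a i v : nat) : memory :=
  Memory (reg m)
    (fun a' j => if (a' == a) && (j == i) then v else arr m a' j).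

(* [run c m t m'] : started in [m], [c] halts in [m'] after [t] steps.
   Evaluating the expressions of a command counts as one step, since their
   size is bounded by that of the program. [Loop e c] repeats [c] as many times
   as the value of [e] on entry. *)
Inductive run : cmd -> memory -> nat -> memory -> Prop :=
  | RunSkip m : run Skip m 1 m
  | RunSet x e m : run (Assign x e) m 1 (set_reg m x (eval m e))
  | RunPut a i e m : run (Put a i e) m 1 (set_arr m a (eval m i) (eval m e))
  | RunSeq c d m t m' u m'' :
      run c m t m' -> run d m' u m'' -> run (Seq c d) m (t + u)%N m''
  | RunIf b c d m t m' :
      run (if holds m b then c else d) m t m' -> run (If b c d) m t.+1 m'
  | RunWhile b c m t m' :
      run (if holds m b then Seq c (While b c) else Skip) m t m' ->
      run (While b c) m t.+1 m'
  | RunLoop e c m t m' :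
      run (iter (eval m e) (Seq c) Skip) m t m' -> run (Loop e c) m t.+1 m'.

Section Encoding.
Variables (R : realType) (S A : finType) (G : game R S A).
Variable r : S -> A -> A -> bool.

(* The transition table, state by state as in adjacency lists. *)
Definition transitions : seq (round S A * S) :=
  [seq x | s <- enum S,
    x <- [seq y | a <- enum (avail1 G s),
      y <- [seq (s, a, b, t) | b <- enum (avail2 G s),
                               t <- enum (Succ G s a b)]]].

(* Input: number of states, actions and transitions in registers 0-2; source,
   the two actions, target and reward of each transition in arrays 0-4. All
   other cells are 0. The probabilities themselves are not part of the input,
   as ASP depends on the supports only. *)
Definition input : memory := Memory
  (nth 0%N [:: #|S|; #|A|; size transitions])
  (fun k => nth 0%N (nth [::]
    [:: [seq val (enum_rank x.1.1.1) | x <- transitions];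
        [seq val (enum_rank x.1.1.2) | x <- transitions];
        [seq val (enum_rank x.1.2) | x <- transitions];
        [seq val (enum_rank x.2) | x <- transitions];
        [seq nat_of_bool (r x.1.1.1 x.1.1.2 x.1.2) | x <- transitions]] k)).

(* The input is intact and array 5 is the characteristic function of [Y]; the
   remaining cells are arbitrary. *)
Definition encodes (Y : {set S}) (m : memory) : Prop :=
  [/\ forall x, (x < 3)%N -> reg m x = reg input x,
      forall k i, (k < 5)%N -> arr m k i = arr input k i
    & forall s : S, arr m 5 (enum_rank s) = (s \in Y)].

Lemma size_transitions : size transitions = delta_size G.
Proof.
rewrite /transitions size_allpairs_dep sumnE big_map big_enum.
apply: eq_bigr => s _; rewrite size_allpairs_dep sumnE big_map big_enum /=.
apply: eq_bigr => a _; rewrite size_allpairs_dep sumnE big_map big_enum /=.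
by apply: eq_bigr => b _; rewrite cardE.
Qed.

Lemma encodes_input : encodes finset.set0 input.
Proof. by split=> // s; rewrite inE /= nth_nil. Qed.

End Encoding.

(* #|S| rounds of fixpoint iteration, when [nu] computes [nuZ]; started from
   [input], they begin with the empty set by [encodes_input]. *)
Definition mu_loop (nu : cmd) : cmd := Loop (Reg 0) nu.

(* Main.v *)
(* Let Y be the fixpoint. Outside Y, player 2 plays uniformly among the actions
   that cannot lead to Y against any action of player 1. The play then never
   enters Y and, since Y = nu Z. ASP(S,Y,Z), each state outside Y has a rank such
   that every action of player 1 gives, with probability bounded below, reward 0
   or a decrease of the rank. Weighting 2^-(number of zeros) by a function of the
   rank gives a supermartingale with geometric decay, so that the frequency of
   zeros being small has exponentially small probability, and Borel-Cantelli
   bounds the limsup average away from 1.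

   Inside Y, player 1 plays a Good action of the current layer of the iteration
   of Y, except with probability 1/(k+2)^2 in round k, when all actions are equally
   likely. If with positive probability player 2 ever plays a Bad action before
   the layer changes, then a lower layer is reached with positive probability,
   and induction applies. Otherwise the event that only Good actions are played
   from now on has positive probability, as the product of the 1 - 1/(k+2)^2
   converges, and on it all rewards are 1.

   Once these two inclusions are known, the eight equalities follow by inclusion
   of events, because the two players cannot both succeed on disjoint events.

   For the complexity, nu Z. ASP(S,Y,Z) is computed in time O(|delta|) by deleting
   states with a worklist: an action of player 1 dies with its first transition
   under a non-Bad action of player 2 that has reward 0 or a deleted target, and
   a state is deleted when the number of its live actions drops to 0. *)
Require Import Defs.
From HB Require Import structures.
From mathcomp Require Import all_boot all_order all_algebra.
From mathcomp Require Import all_classical all_reals all_analysis.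
From mathcomp Require Import ring lra zify.

Set Implicit Arguments.
Unset Strict Implicit.
Unset Printing Implicit Defensive.

Import Order.TTheory GRing.Theory Num.Theory.
Import numFieldNormedType.Exports.

(** * Successors, Bad actions and the inner greatest fixpoint *)

Lemma dist_ex (R : realType) (T : finType) (p : T -> R) :
  is_dist p -> exists x, (0 < p x)%R.
Proof.
move=> [p0 p1]; apply/existsP; rewrite -[[exists _, _]]negbK; apply/negP.
move=> /existsPn h; have := oner_neq0 R; rewrite -p1 big1 ?eqxx // => x _.
by apply/eqP; move: (h x); rewrite lt_def p0 andbT negbK.
Qed.

Section GameBasics.
Variables (R : realType) (S A : finType) (G : game R S A).
Variable r : S -> A -> A -> bool.

Lemma Succ_ex s a b : a \in avail1 G s -> b \in avail2 G s ->
  exists t, t \in Succ G s a b.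
Proof.
move=> aG bG; have [t t0] := dist_ex (delta_dist aG bG).
by exists t; rewrite inE.
Qed.

Lemma Allow1_setT s : Allow1 G s [set: S]%SET = avail1 G s.
Proof.
apply/finset.setP => a; rewrite inE; case: (a \in _) => //=.
by apply/forall_inP => b _; exact: finset.subsetT.
Qed.

Lemma Bad2P s (Z : {set S}) b : b \in avail2 G s ->
  reflect (exists2 a, a \in avail1 G s & exists2 t, t \in Succ G s a b & t \in Z)
    (b \in Bad2 G s [set: S]%SET Z).
Proof.
move=> bG; rewrite inE bG Allow1_setT; apply: (iffP exists_inP).
  by move=> [a aG /set0Pn[t]]; rewrite inE => /andP[tS tZ]; exists a => //; exists t.
by move=> [a aG [t tS tZ]]; exists a => //; apply/set0Pn; exists t; rewrite inE tS.
Qed.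

Lemma nuZ_fix (Y : {set S}) :
  ASP G r [set: S]%SET Y (nuZ G r Y) = nuZ G r Y.
Proof.
by apply: cofixsetK => Z Z' ZZ'; apply: ASP_mono; rewrite // fintype.subxx.
Qed.

(** Coinduction: the iteration starts from the full set, and by monotonicity every iterate still
    contains the post-fixpoint [Z]. *)
Lemma nuZ_max (Y Z : {set S}) : Z \subset ASP G r [set: S]%SET Y Z ->
  Z \subset nuZ G r Y.
Proof.
move=> ZA; rewrite /nuZ /cofixset /fixset.
elim: #|S| => [|k IH]; first by rewrite finset.setC0 finset.subsetT.
rewrite /= /funsetC finset.setCK; apply: fintype.subset_trans ZA _.
exact: ASP_mono.
Qed.

End GameBasics.

(** * Linear-time computation of the inner fixpoint *)

Fixpoint flat (c : cmd) : bool :=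
  match c with
  | Skip | Assign _ _ | Put _ _ _ => true
  | Seq c d | If _ c d => flat c && flat d
  | While _ _ | Loop _ _ => false
  end.

(** A functional counterpart of [run]. The value on [While] is a dummy: agreement with [run] is only
    proved for commands without [While]. *)
Fixpoint exec (c : cmd) (m : memory) : memory :=
  match c with
  | Skip | While _ _ => m
  | Assign x e => set_reg m x (Defs.eval m e)
  | Put a i e => set_arr m a (Defs.eval m i) (Defs.eval m e)
  | Seq c d => exec d (exec c m)
  | If b c d => if holds m b then exec c m else exec d m
  | Loop e c => iter (Defs.eval m e) (exec c) m
  end.

Fixpoint cmd_size (c : cmd) : nat :=
  match c with
  | Skip | Assign _ _ | Put _ _ _ => 1
  | Seq c d => cmd_size c + cmd_size d
  | If _ c d => (cmd_size c + cmd_size d).+1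
  | While _ c | Loop _ c => (cmd_size c).+2
  end.

Lemma run_flat c m : flat c ->
  exists2 t, t <= cmd_size c & run c m t (exec c m).
Proof.
elim: c m => [|x e|a i e|c IHc d IHd|b c IHc d IHd|//|//] m /=.
- by exists 1 => //; constructor.
- by exists 1 => //; constructor.
- by exists 1 => //; constructor.
- move=> /andP[/IHc-/(_ m)[t tc rc] /IHd-/(_ (exec c m))[u ud rd]].
  by exists (t + u); [exact: leq_add|apply: RunSeq rc rd].
- move=> /andP[/IHc-/(_ m)[t tc rc] /IHd-/(_ m)[u ud rd]].
  exists (if holds m b then t else u).+1; first by case: holds; lia.
  by apply: RunIf; case: holds.
Qed.

Definition runs (c : cmd) (m : memory) (T : nat) (m' : memory) : Prop :=
  exists2 t, t <= T & run c m t m'.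

Lemma runs_seq c d m m' m'' T U :
  runs c m T m' -> runs d m' U m'' -> runs (Seq c d) m (T + U) m''.
Proof.
by move=> [t tT rc] [u uU rd]; exists (t + u);
  [exact: leq_add|apply: RunSeq rc rd].
Qed.

Lemma runs_loop e c m : flat c ->
  runs (Loop e c) m (Defs.eval m e * cmd_size c + 2) (exec (Loop e c) m).
Proof.
move=> fc /=; suff H N m0 : runs (iter N (Seq c) Skip) m0 (N * cmd_size c + 1)
    (iter N (exec c) m0).
  by have [t tT r] := H (Defs.eval m e) m; exists t.+1; [lia|exact: RunLoop].
elim: N m0 => [|N IH] m0; first by exists 1 => //; constructor.
rewrite mulSn -addnA [iter _ (exec c) _]iterSr; apply: runs_seq (IH _).
exact: run_flat.
Qed.

Fixpoint written (c : cmd) : seq nat :=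
  match c with
  | Skip | Assign _ _ => [::]
  | Put a _ _ => [:: a]
  | Seq c d | If _ c d => written c ++ written d
  | While _ c | Loop _ c => written c
  end.

Fixpoint assigned (c : cmd) : seq nat :=
  match c with
  | Skip | Put _ _ _ => [::]
  | Assign x _ => [:: x]
  | Seq c d | If _ c d => assigned c ++ assigned d
  | While _ c | Loop _ c => assigned c
  end.

(** Frame rule: carries what one pass of the program has established through the later passes. *)
Lemma exec_arr c m a : a \notin written c -> arr (exec c m) a = arr m a.
Proof.
elim: c m => //= [b i e|c IHc d IHd|b c IHc d IHd|e c IHc] m.
- by rewrite inE => /negbTE ->.
- by rewrite mem_cat negb_or => /andP[ac ad]; rewrite IHd // IHc.
- rewrite mem_cat negb_or => /andP[ac ad].
  by case: holds; [exact: IHc|exact: IHd].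
- by move=> ac; elim: (Defs.eval m e) => //= N <-; exact: IHc.
Qed.

Lemma exec_reg c m x : x \notin assigned c -> reg (exec c m) x = reg m x.
Proof.
elim: c m => //= [y e|c IHc d IHd|b c IHc d IHd|e c IHc] m.
- by rewrite inE => /negbTE ->.
- by rewrite mem_cat negb_or => /andP[ac ad]; rewrite IHd // IHc.
- rewrite mem_cat negb_or => /andP[ac ad].
  by case: holds; [exact: IHc|exact: IHd].
- by move=> ac; elim: (Defs.eval m e) => //= N <-; exact: IHc.
Qed.

Definition for_ (e : expr) (c : cmd) : cmd :=
  Seq (Assign 3 (Cst 0)) (Loop e (Seq c (Assign 3 (Inc (Reg 3))))).

(** Invariant rule for counting loops: as the body leaves register 3 alone, this register is the
    number of completed turns. *)
Lemma for_ind (P : nat -> memory -> Prop) e c m N :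
  3 \notin assigned c -> Defs.eval (set_reg m 3 0) e = N ->
  P 0 (set_reg m 3 0) ->
  (forall k m', k < N -> reg m' 3 = k -> P k m' ->
    P k.+1 (set_reg (exec c m') 3 k.+1)) ->
  P N (exec (for_ e c) m).
Proof.
move=> c3 /= -> P0 PS.
suff H k : k <= N -> let m' := iter k (exec (Seq c (Assign 3 (Inc (Reg 3)))))
    (set_reg m 3 0) in reg m' 3 = k /\ P k m' by have [] := H N (leqnn N).
elim: k => [//|k IH] kN /=; have [r3 Pk] := IH (ltnW kN).
split; first by rewrite exec_reg // r3.
rewrite exec_reg // r3; exact: PS.
Qed.

(** Loops are not nested, and each is bounded by register 0 or 2, which hold |S| and |delta|. If
    these registers are never assigned, the time is linear in a common bound of both. *)
Fixpoint single_pass (c : cmd) : bool :=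
  match c with
  | Seq c d => single_pass c && single_pass d
  | Loop (Reg x) c => flat c && (x \in [:: 0; 2])
  | c => flat c
  end.

Lemma runs_single_pass c m B : single_pass c ->
  0 \notin assigned c -> 2 \notin assigned c -> reg m 0 <= B -> reg m 2 <= B ->
  runs c m (cmd_size c * B.+1) (exec c m).
Proof.
have flat_case d m' : flat d -> runs d m' (cmd_size d * B.+1) (exec d m').
  by move=> /(run_flat m')[t td rt]; exists t => //; nia.
elim: c m => [|x e|a i e|c IHc d IHd|b c _ d _|b c _|e c _] m;
  try by move=> fc *; exact: flat_case.
- move=> /= /andP[pc pd]; rewrite !mem_cat !negb_or.
  move=> /andP[c0 d0] /andP[c2 d2] m0 m2; rewrite mulnDl.
  by apply: runs_seq; [exact: IHc|apply: IHd; rewrite ?exec_reg].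
case: e => //= x /andP[fc xE] c0 c2 m0 m2.
have [t tT r] := runs_loop (Reg x) m fc; exists t => //; apply: leq_trans tT _.
have xB : reg m x <= B by move: xE; rewrite !inE => /orP[] /eqP ->.
rewrite /=; nia.
Qed.
(* Identifies in array q each transition with the first one that has the same
   source and the same action in array x. Array l maps an action to a candidate for
   that first transition; it needs no initialization, as a candidate is
   checked before use. *)
Definition rep_cmd (x l q : nat) : cmd :=
  let prev := Get l (Get x (Reg 3)) in
  let fresh := Put l (Get x (Reg 3)) (Reg 3) in
  Seq (If (TestLt prev (Reg 3))
        (If (TestEq (Get 0 prev) (Get 0 (Reg 3)))
          (If (TestEq (Get x prev) (Get x (Reg 3))) Skip fresh) fresh) fresh)
      (Put q (Reg 3) prev).

(** * Grouping the transitions by source and action *)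

Section Representatives.
Variables (M : nat) (src X : nat -> nat).
Hypothesis src_sorted : forall i j, i <= j -> j < M -> src i <= src j.

Definition same i j := (src i == src j) && (X i == X j).

Definition rep i := find (same i) (iota 0 M).

Lemma same_sym i j : same i j = same j i.
Proof. by rewrite /same [src i == _]eq_sym [X i == _]eq_sym. Qed.

Lemma rep_same i : i < M -> same i (rep i).
Proof.
move=> iM; have h : has (same i) (iota 0 M).
  by apply/hasP; exists i; rewrite ?mem_iota // /same !eqxx.
by have := nth_find 0 h; rewrite nth_iota // -[X in _ < X](size_iota 0) -has_find.
Qed.

Lemma rep_le i j : j < M -> same i j -> rep i <= j.
Proof.
move=> jM sij; rewrite leqNgt; apply/negP => /(before_find 0).
by rewrite nth_iota // add0n sij.
Qed.

Lemma rep_lt i : i < M -> rep i < M.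
Proof.
by move=> iM; apply: leq_ltn_trans (iM); apply: rep_le => //; rewrite /same !eqxx. Qed.

Lemma rep_eq i j : i < M -> j < M -> (rep i == rep j) = same i j.
Proof.
move=> iM jM; apply/eqP/idP => [e|/andP[/eqP e1 /eqP e2]]; last first.
  by apply: eq_find => k; rewrite /same e1 e2.
have /andP[/eqP + /eqP] := rep_same iM; have /andP[/eqP + /eqP] := rep_same jM.
by rewrite e /same => -> -> -> ->; rewrite !eqxx.
Qed.

Lemma rep_rep i : i < M -> rep (rep i) = rep i.
Proof.
by move=> iM; apply/eqP; rewrite rep_eq ?rep_lt // same_sym rep_same.
Qed.

(** The invariant claims correct cells of [l] only for actions already seen in the block of the
    latest source. A cell that passes the three tests, even by accident, points to an earlier
    transition of the same class; by the invariant its content is then the representative. *)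
Lemma exec_rep x l q m :
  uniq [:: 0; x; l; q] -> reg m 2 = M -> arr m 0 =1 src -> arr m x =1 X ->
  forall i, i < M -> arr (exec (for_ (Reg 2) (rep_cmd x l q)) m) q i = rep i.
Proof.
move=> /= /andP[+ /andP[+ /andP[+ _]]].
rewrite !inE !negb_or => /and3P[x0 l0 q0] /andP[xl xq] lq m2 m0 mx.
pose P k m' := [/\ arr m' 0 =1 src, arr m' x =1 X,
  forall i, i < k -> arr m' q i = rep i
  & forall i, i < k -> src i = src k.-1 -> arr m' l (X i) = rep i].
suff [_ _ ? _] : P M (exec (for_ (Reg 2) (rep_cmd x l q)) m) by [].
apply: for_ind => [//|//|//|k m' kM mk [h0 hx hq hl]].
(* The memory after the nested tests: the candidate is overwritten unless it is an earlier
   transition of the same class. *)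
pose U := if [&& arr m' l (X k) < k, src (arr m' l (X k)) == src k
                & X (arr m' l (X k)) == X k] then m' else set_arr m' l (X k) k.
have -> : exec (rep_cmd x l q) m' = set_arr U q k (arr U l (X k)).
  rewrite /rep_cmd /= !mk !hx !h0 /U /=.
  case: (_ < _) => /=; last by rewrite mk (negbTE xl) hx.
  case: (_ == src k) => /=; last by rewrite mk (negbTE xl) hx.
  by case: (_ == _) => /=; rewrite mk ?(negbTE xl) hx.
have [U0 Ux Uq] : [/\ arr U 0 =1 src, arr U x =1 X & arr U q = arr m' q].
  rewrite /U; case: ifP => _ //=; rewrite (negbTE l0) (negbTE xl).
  by rewrite [q == l]eq_sym (negbTE lq).
have Ul i : i <= k -> src i = src k -> arr U l (X i) = rep i.
  move=> ik sik.
  (* Sortedness squeezes [src k.-1] between [src j] and [src k], so the invariant, stated for the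
     block of [k.-1], applies to [j]. *)
  have old j : j < k -> src j = src k -> arr m' l (X j) = rep j.
    move=> jk sjk; apply: hl => //.
    have h1 : src j <= src k.-1 by apply: src_sorted; lia.
    have h2 : src k.-1 <= src k by apply: src_sorted; lia.
    by lia.
  rewrite /U; case: ifP => [/and3P[lk /eqP ls /eqP lX]|].
    move: ik; rewrite leq_eqVlt => /predU1P[->|ik]; last exact: old.
    have := old _ lk ls; rewrite lX => e.
    rewrite {1}e; apply/eqP; rewrite rep_eq; [|exact: ltn_trans kM|by []].
    by rewrite /same ls lX !eqxx.
  move=> /negP nk /=; rewrite eqxx /=.
  (* A failed test means that [k] opens its class: otherwise the invariant would have put [rep k]
     into the cell, and it would have passed. *)
  have kk : rep k = k.
    apply/eqP; rewrite eqn_leq leqNgt; apply/andP; split.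
      by rewrite -leqNgt; apply: rep_le => //; rewrite /same !eqxx.
    rewrite leqNgt; apply/negP => kk; have /andP[/eqP s1 /eqP s2] := rep_same kM.
    have /old e : rep k < k by [].
    move: (e (esym s1)); rewrite -s2 rep_rep // => el.
    by apply: nk; rewrite el kk -s1 -s2 !eqxx.
  have [e|ne] := eqVneq (X i) (X k).
    by apply/eqP; rewrite -{1}kk rep_eq //; [rewrite /same sik e !eqxx|lia].
  by apply: old => //; move: ik ne; case: ltngtP => // ->; rewrite eqxx.
split => /=.
- by rewrite (negbTE q0).
- by rewrite (negbTE xq).
- move=> i; rewrite eqxx ltnS leq_eqVlt /=.
  case: eqVneq => [-> _|_ /hq <-]; first exact: Ul.
  by rewrite Uq.
- by move=> i ik sik; rewrite (negbTE lq); apply: Ul.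
Qed.

End Representatives.
(* Registers: 3 loop index, 4 height of the stack, 5 head of the list being
   traversed. Arrays: 7 and 9 representatives of the pairs of source and action
   of player 1, resp. 2; 10 flags on the latter, for Bad actions; 11 flags on
   the former, for dead actions; 12 and 13 linked lists of the transitions by
   target, where i.+1 points to transition i and 0 is nil; 14 numbers of live
   actions of the states; 15 stack of deleted states. *)
Definition clear_cmd : cmd :=
  Seq (Put 12 (Reg 3) (Cst 0)) (Put 14 (Reg 3) (Cst 0)).

Definition link_cmd : cmd :=
  Seq (Seq (Put 10 (Reg 3) (Cst 0)) (Put 11 (Reg 3) (Cst 0)))
      (Seq (Put 13 (Reg 3) (Get 12 (Get 3 (Reg 3))))
           (Put 12 (Get 3 (Reg 3)) (Inc (Reg 3)))).

(** Each action of player 1 is counted once, at its representative. *)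
Definition count_cmd : cmd :=
  If (TestEq (Get 7 (Reg 3)) (Reg 3))
    (Put 14 (Get 0 (Reg 3)) (Inc (Get 14 (Get 0 (Reg 3))))) Skip.

Definition mark_cmd : cmd :=
  If (TestEq (Get 5 (Get 3 (Reg 3))) (Cst 0)) Skip
    (Put 10 (Get 9 (Reg 3)) (Cst 1)).

Definition setup_cmd : cmd :=
  Seq (for_ (Reg 0) clear_cmd)
 (Seq (for_ (Reg 2) (rep_cmd 1 6 7))
 (Seq (for_ (Reg 2) (rep_cmd 2 8 9))
 (Seq (for_ (Reg 2) link_cmd)
 (Seq (for_ (Reg 2) count_cmd)
      (for_ (Reg 2) mark_cmd))))).

Fixpoint chain (next : nat -> nat) (c : nat) (l : seq nat) : Prop :=
  if l is j :: l' then c = j.+1 /\ chain next (next j) l' else c = 0.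

Lemma chain_eq (f g : nat -> nat) c l :
  {in l, f =1 g} -> chain f c l -> chain g c l.
Proof.
elim: l c => //= j l IH c fg [-> h]; split => //.
rewrite -fg ?mem_head //; apply: IH h => i il.
by apply: fg; rewrite inE il orbT.
Qed.

Lemma iota0S k : iota 0 k.+1 = iota 0 k ++ [:: k].
Proof. by rewrite -[k.+1]addn1 iotaD. Qed.

(** * The tables prepared before any state is deleted *)

Section Table.
Variables (n M : nat) (src a1 a2 tgt rw Y : nat -> nat).

(** With the full set as first argument of [ASP], every available action is in [Allow1]; hence an
    action of player 2 is Bad as soon as one of its transitions enters [Y]. *)
Definition bad_round i := has (fun k => (rep M src a2 k == rep M src a2 i) &&
  (Y (tgt k) != 0)) (iota 0 M).

(** Reversed because [link_cmd] inserts at the head of the list. *)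
Definition pred_list t := rev [seq j <- iota 0 M | tgt j == t].

Definition table_ready m :=
  [/\ reg m 0 = n, reg m 2 = M, arr m 0 =1 src & arr m 4 =1 rw] /\
  [/\ forall i, i < M -> arr m 7 i = rep M src a1 i,
      forall i, i < M -> arr m 9 i = rep M src a2 i,
      forall i, i < M -> (arr m 10 (rep M src a2 i) != 0) = bad_round i
    & forall t, t < n -> chain (arr m 13) (arr m 12 t) (pred_list t)].

End Table.

Section Setup.
Variables (n M : nat) (src a1 a2 tgt rw : nat -> nat) (m : memory).
Hypothesis src_sorted : forall i j, i <= j -> j < M -> src i <= src j.
Hypotheses (reg0 : reg m 0 = n) (reg2 : reg m 2 = M).
Hypotheses (arr0 : arr m 0 =1 src) (arr1 : arr m 1 =1 a1) (arr2 : arr m 2 =1 a2).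
Hypotheses (arr3 : arr m 3 =1 tgt) (arr4 : arr m 4 =1 rw).

Local Notation repa := (rep M src a1).
Local Notation repb := (rep M src a2).

Local Notation bad := (bad_round M src a2 tgt (arr m 5)).
Local Notation preds := (pred_list M tgt).
Local Notation ready := (table_ready n M src a1 a2 tgt rw (arr m 5)).

Lemma exec_clear m0 : reg m0 0 = n -> forall s, s < n ->
  arr (exec (for_ (Reg 0) clear_cmd) m0) 12 s = 0 /\
  arr (exec (for_ (Reg 0) clear_cmd) m0) 14 s = 0.
Proof.
move=> r0; apply: (@for_ind (fun k m' => forall s, s < k ->
  arr m' 12 s = 0 /\ arr m' 14 s = 0)) => // k m' kn mk IH s.
rewrite /= mk ltnS leq_eqVlt.
by case: eqVneq => //= _ /IH.
Qed.

Lemma exec_link m0 : reg m0 2 = M -> arr m0 3 =1 tgt ->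
  (forall s, s < n -> arr m0 12 s = 0) ->
  let m' := exec (for_ (Reg 2) link_cmd) m0 in
  (forall i, i < M -> arr m' 10 i = 0 /\ arr m' 11 i = 0) /\
  (forall t, t < n -> chain (arr m' 13) (arr m' 12 t) (preds t)).
Proof.
move=> r2 h3 h12.
pose P k m' := [/\ arr m' 3 =1 tgt,
  forall i, i < k -> arr m' 10 i = 0 /\ arr m' 11 i = 0
  & forall t, t < n -> chain (arr m' 13) (arr m' 12 t)
                        (rev [seq j <- iota 0 k | tgt j == t])].
suff [] : P M (exec (for_ (Reg 2) link_cmd) m0) by [].
apply: for_ind => // k m' kM mk [p3 p10 p13]; rewrite /P iota0S; split => //=.
  move=> i; rewrite mk ltnS leq_eqVlt.
  by case: eqVneq => //= _ /p10.
move=> t tn; rewrite mk p3.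
rewrite filter_cat rev_cat /= eq_sym.
(* Writing cell [k] of array 13 does not disturb the existing lists, whose members are all below
   [k]. *)
have H c : chain (arr m' 13) c (rev [seq j <- iota 0 k | tgt j == t]) ->
  chain (fun j => if j == k then arr m' 12 (tgt k) else arr m' 13 j) c
    (rev [seq j <- iota 0 k | tgt j == t]).
  apply: chain_eq => j; rewrite mem_rev mem_filter mem_iota.
  by case: (eqVneq j k) => // ->; rewrite add0n ltnn !andbF.
case: eqVneq => [e|_] /=; last exact: H _ (p13 _ tn).
rewrite eqxx; split=> //; have := H _ (p13 _ tn).
by rewrite [X in arr m' 12 X]e.
Qed.

Lemma exec_count m0 : reg m0 2 = M -> arr m0 0 =1 src ->
  (forall i, i < M -> arr m0 7 i = repa i) ->
  (forall s, s < n -> arr m0 14 s = 0) ->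
  forall s, s < n -> arr (exec (for_ (Reg 2) count_cmd) m0) 14 s =
    count (fun p => (repa p == p) && (src p == s)) (iota 0 M).
Proof.
move=> r2 h0 h7 h14.
pose P k m' := [/\ arr m' 0 =1 src, arr m' 7 = arr m0 7
  & forall s, s < n -> arr m' 14 s =
      count (fun p => (repa p == p) && (src p == s)) (iota 0 k)].
suff [] : P M (exec (for_ (Reg 2) count_cmd) m0) by [].
apply: for_ind => // k m' kM mk [p0 p7 p14].
rewrite /P iota0S /= mk p0 p7 h7 //; split=> [||s sn].
- by case: ifP => _; exact: p0.
- by case: ifP => _; exact: p7.
rewrite count_cat /= addn0 -p14 //.
case: (repa k == k) => //=; last by rewrite addn0.
by rewrite eq_sym; case: eqVneq => [->|_]; rewrite ?addn1 ?addn0.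
Qed.

Lemma exec_mark m0 : reg m0 2 = M -> arr m0 3 =1 tgt -> arr m0 5 = arr m 5 ->
  (forall i, i < M -> arr m0 9 i = repb i) ->
  (forall i, i < M -> arr m0 10 i = 0) ->
  forall i, i < M ->
    (arr (exec (for_ (Reg 2) mark_cmd) m0) 10 (repb i) != 0) = bad i.
Proof.
move=> r2 h3 h5 h9 h10.
pose P k m' := [/\ arr m' 3 =1 tgt, arr m' 5 = arr m0 5, arr m' 9 = arr m0 9
  & forall i, i < M -> (arr m' 10 (repb i) != 0) =
      has (fun k => (repb k == repb i) && (arr m 5 (tgt k) != 0)) (iota 0 k)].
suff [] : P M (exec (for_ (Reg 2) mark_cmd) m0) by [].
apply: for_ind => //.
  by split=> // i iM /=; rewrite h10 // rep_lt.
move=> k m' kM mk [p3 p5 p9 p10].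
rewrite /P iota0S /= mk p3 p5 h5 p9 h9 //; split=> [||| i iM].
- by case: ifP => _; exact: p3.
- by case: ifP => _; rewrite /= p5 h5.
- by case: ifP => _; exact: p9.
rewrite has_cat /= orbF -p10 //.
case: (arr m 5 (tgt k) == 0) => /=; first by rewrite andbF orbF.
by rewrite andbT [repb i == _]eq_sym; case: (repb k == _); rewrite ?orbT ?orbF.
Qed.

Lemma exec_setup : let m' := exec setup_cmd m in
  [/\ ready m', forall p, p < M -> arr m' 11 p = 0
    & forall s, s < n -> arr m' 14 s =
        count (fun p => (repa p == p) && (src p == s)) (iota 0 M)].
Proof.
rewrite [exec setup_cmd m]/=.
(* [m1] to [m6] are the memories after the six passes, each with the arrays and registers that its
   pass leaves unchanged. *)
set m1 := exec (for_ (Reg 0) clear_cmd) m.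
rewrite -[iter _ _ _]/(exec (for_ (Reg 2) mark_cmd)
  (exec (for_ (Reg 2) count_cmd) (exec (for_ (Reg 2) link_cmd)
  (exec (for_ (Reg 2) (rep_cmd 2 8 9)) (exec (for_ (Reg 2) (rep_cmd 1 6 7)) m1))))).
have m1P := exec_clear reg0; rewrite -/m1 in m1P.
have m1f a : a \notin [:: 12; 14] -> arr m1 a = arr m a
  by move=> h; rewrite /m1 exec_arr.
have m1r x : x != 3 -> reg m1 x = reg m x.
  by move=> x3; rewrite /m1 exec_reg // !inE !orbb.
set m2 := exec _ m1.
have m2f a : a \notin [:: 6; 6; 6; 7] -> arr m2 a = arr m1 a
  by move=> h; rewrite /m2 exec_arr.
have m2r x : x != 3 -> reg m2 x = reg m1 x.
  by move=> x3; rewrite /m2 exec_reg // !inE !orbb.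
set m3 := exec _ m2.
have m3f a : a \notin [:: 8; 8; 8; 9] -> arr m3 a = arr m2 a
  by move=> h; rewrite /m3 exec_arr.
have m3r x : x != 3 -> reg m3 x = reg m2 x.
  by move=> x3; rewrite /m3 exec_reg // !inE !orbb.
set m4 := exec _ m3.
have m4f a : a \notin [:: 10; 11; 13; 12] -> arr m4 a = arr m3 a
  by move=> h; rewrite /m4 exec_arr.
have m4r x : x != 3 -> reg m4 x = reg m3 x.
  by move=> x3; rewrite /m4 exec_reg // !inE !orbb.
set m5 := exec _ m4.
have m5f a : a \notin [:: 14] -> arr m5 a = arr m4 a
  by move=> h; rewrite /m5 exec_arr.
have m5r x : x != 3 -> reg m5 x = reg m4 x.
  by move=> x3; rewrite /m5 exec_reg // !inE !orbb.
set m6 := exec _ m5.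
have m6f a : a \notin [:: 10] -> arr m6 a = arr m5 a
  by move=> h; rewrite /m6 exec_arr.
have m6r x : x != 3 -> reg m6 x = reg m5 x.
  by move=> x3; rewrite /m6 exec_reg // !inE !orbb.
have H7 : forall i, i < M -> arr m2 7 i = repa i.
  by apply: exec_rep => //; rewrite ?m1r ?m1f.
have H9 : forall i, i < M -> arr m3 9 i = repb i.
  by apply: exec_rep => //; rewrite ?m2r ?m1r ?m2f ?m1f.
have [|||H10 H13] := @exec_link m3.
- by rewrite m3r // m2r // m1r.
- by rewrite m3f // m2f // m1f.
- by move=> s /m1P[h _]; rewrite m3f // m2f.
have H14 : forall s, s < n -> arr m5 14 s =
    count (fun p => (repa p == p) && (src p == s)) (iota 0 M).
  apply: exec_count.
  - by rewrite m4r // m3r // m2r // m1r.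
  - by rewrite m4f // m3f // m2f // m1f.
  - by move=> i iM; rewrite m4f // m3f // H7.
  - by move=> s /m1P[_ h]; rewrite m4f // m3f // m2f.
have Hb : forall i, i < M -> (arr m6 10 (repb i) != 0) = bad i.
  apply: exec_mark.
  - by rewrite m5r // m4r // m3r // m2r // m1r.
  - by rewrite m5f // m4f // m3f // m2f // m1f.
  - by rewrite m5f // m4f // m3f // m2f // m1f.
  - by move=> i iM; rewrite m5f // m4f // H9.
  - by move=> i /H10[h _]; rewrite m5f.
split.
- split; split.
  + by rewrite m6r // m5r // m4r // m3r // m2r // m1r.
  + by rewrite m6r // m5r // m4r // m3r // m2r // m1r.
  + by rewrite m6f // m5f // m4f // m3f // m2f // m1f.
  + by rewrite m6f // m5f // m4f // m3f // m2f // m1f.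
  + by rewrite m6f // m5f // m4f // m3f.
  + by rewrite m6f // m5f // m4f.
  + by [].
  + by rewrite !m6f // !m5f.
- by move=> p /H10[_ h]; rewrite m6f // m5f.
- by rewrite m6f.
Qed.

End Setup.

(** * Deletion of states with a worklist *)

Definition process_cmd : cmd :=
  If (TestEq (Get 10 (Get 9 (Reg 3))) (Cst 0))
    (If (TestEq (Get 11 (Get 7 (Reg 3))) (Cst 0))
      (Seq (Put 11 (Get 7 (Reg 3)) (Cst 1))
      (Seq (Put 14 (Get 0 (Reg 3)) (Dec (Get 14 (Get 0 (Reg 3)))))
        (If (TestEq (Get 14 (Get 0 (Reg 3))) (Cst 0))
          (Seq (Put 15 (Reg 4) (Get 0 (Reg 3))) (Assign 4 (Inc (Reg 4))))
          Skip)))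
      Skip)
    Skip.

Definition scan_cmd : cmd :=
  If (TestEq (Get 4 (Reg 3)) (Cst 0)) process_cmd Skip.

(* One step of the traversal: it pops a state or consumes a cell of the current
   list, so that |S| + |delta| steps suffice and no inner loop is needed. *)
Definition drain_cmd : cmd :=
  If (TestEq (Reg 5) (Cst 0))
    (If (TestEq (Reg 4) (Cst 0)) Skip
      (Seq (Assign 4 (Dec (Reg 4))) (Assign 5 (Get 12 (Get 15 (Reg 4))))))
    (Seq (Assign 3 (Dec (Reg 5)))
      (Seq (Assign 5 (Get 13 (Reg 3))) process_cmd)).

Lemma count_predD1 (T : eqType) (P : pred T) (s : seq T) x :
  uniq s -> x \in s -> P x ->
  count P s = (count (fun y => P y && (y != x)) s).+1.
Proof.
move=> + + Px; elim: s => //= y s IH /andP[ys us]; rewrite inE.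
have [e _|yx /=] := eqVneq x y.
  rewrite -e Px /= add0n add1n; congr _.+1; apply: eq_in_count => z zs.
  case: (eqVneq z x) => [ez|_]; last by rewrite andbT.
  by rewrite -e -ez zs in ys.
by move=> /(IH us) ->; rewrite andbT addnS.
Qed.

Definition output_cmd : cmd :=
  If (TestEq (Get 14 (Reg 3)) (Cst 0)) (Put 5 (Reg 3) (Cst 0))
    (Put 5 (Reg 3) (Cst 1)).

Lemma sum_pred1 n x : x < n -> \sum_(0 <= t < n) (x == t) = 1.
Proof.
move=> xn; rewrite (bigD1_seq x) ?iota_uniq ?mem_index_iota //= eqxx.
by rewrite big1 // => t; rewrite eq_sym => /negbTE ->.
Qed.

Lemma sum_count (n : nat) (f : nat -> nat) (s : seq nat) :
  all (fun j => f j < n) s ->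
  \sum_(0 <= t < n) count (fun j => f j == t) s = size s.
Proof.
elim: s => [_|j s IH /= /andP[jn sn]]; first by rewrite big1.
by rewrite big_split /= IH // sum_pred1.
Qed.

Section Worklist.
Variables (n M : nat) (src a1 a2 tgt rw : nat -> nat) (Y : nat -> nat).
Hypothesis src_lt : forall i, i < M -> src i < n.
Hypothesis tgt_lt : forall i, i < M -> tgt i < n.

Local Notation repa := (rep M src a1).
Local Notation repb := (rep M src a2).

Local Notation bad := (bad_round M src a2 tgt Y).
Local Notation preds := (pred_list M tgt).
Local Notation ready := (table_ready n M src a1 a2 tgt rw Y).

Definition safe (Z : pred nat) j := Z (tgt j) && (rw j != 0).

(** The inclusion of [Z] in [ASP] of [Z], read off the table: the transition [i] stands for the Good
    action of player 1. *)
Definition postfix (Z : pred nat) := forall s, s < n -> Z s ->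
  exists i, [/\ i < M, src i = s
    & forall j, j < M -> same src a1 i j -> ~~ bad j -> safe Z j].

Definition stack m := mkseq (arr m 15) (reg m 4).

Definition live (m : memory) s p :=
  [&& repa p == p, src p == s & arr m 11 p == 0].

(* Of the transitions into deleted states, those in [l] or into states still on the
   stack may be pending. [Z] is an arbitrary post-fixpoint: it stays disjoint
   from what has been deleted. *)
Definition inv (Z : pred nat) (l : seq nat) m :=
  [/\ forall s, s < n -> arr m 14 s = count (live m s) (iota 0 M),
      all (fun t => (t < n) && ~~ Z t) (stack m),
      forall p, p < M -> arr m 11 p != 0 ->
        exists j, [/\ j < M, repa j = p, ~~ bad j & ~~ safe Z j]
    & forall t, t < n -> arr m 14 t = 0 -> t \in stack m \/
        forall j, j < M -> tgt j = t -> ~~ bad j ->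
          j \in l \/ arr m 11 (repa j) != 0].

(** What the deletion of [t] costs in steps of [drain_cmd]: one to pop it and one for each
    transition into it. *)
Definition weight t := (size (preds t)).+1.

(** States not yet deleted may still have to be paid for, and so must those on the stack. Pushing a
    state moves its weight from the first sum to the second. *)
Definition potential m :=
  \sum_(0 <= t < n) (arr m 14 t != 0) * weight t +
  \sum_(t <- stack m) weight t.

Lemma exec_ready c m : all (mem [:: 11; 14; 15]) (written c) ->
  all (mem [:: 3; 4; 5]) (assigned c) -> ready m -> ready (exec c m).
Proof.
move=> /allP wc /allP ac; have fa a : a \notin [:: 11; 14; 15] -> arr (exec c m) a = arr m a.
  by move=> ha; apply: exec_arr; apply: contra ha => /wc.
have fr x : x \notin [:: 3; 4; 5] -> reg (exec c m) x = reg m x.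
  by move=> hx; apply: exec_reg; apply: contra hx => /ac.
by rewrite /table_ready !fr // !fa.
Qed.

(** For a state of [Z], the post-fixpoint property provides an action all of whose non-Bad
    transitions are safe. An action dies only through an unsafe one, so this action is still live
    and the count is positive. *)
Lemma cnt0_notin Z m s : postfix Z ->
  (forall s, s < n -> arr m 14 s = count (live m s) (iota 0 M)) ->
  (forall p, p < M -> arr m 11 p != 0 ->
    exists j, [/\ j < M, repa j = p, ~~ bad j & ~~ safe Z j]) ->
  s < n -> arr m 14 s = 0 -> ~~ Z s.
Proof.
move=> pZ I1 I3 sn /eqP; rewrite I1 // -leqn0 leqNgt -has_count => nl.
apply/negP => /(pZ _ sn)[i [iM si iP]].
have rM : repa i < M by apply: rep_lt.
have [/I3-/(_ rM)[j [jM rj bj /negP[]]]|] := boolP (arr m 11 (repa i) != 0).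
  by apply: iP => //; rewrite -(rep_eq (M := M)) // rj.
rewrite negbK => d0; case/negP: nl; apply/hasP; exists (repa i).
  by rewrite mem_iota.
rewrite /live rep_rep // d0 eqxx andbT /=.
by have /andP[/eqP <- _] := rep_same src a1 iM; rewrite si.
Qed.

(** Handling [j] removes it from the pending list: either it is Bad, or its action is dead
    afterwards. The flag in array 11 prevents an action from being discounted twice. *)
Lemma exec_process Z j l m : ready m -> reg m 3 = j -> j < M ->
  (~~ bad j -> ~~ safe Z j) -> postfix Z -> inv Z (j :: l) m ->
  let m' := exec process_cmd m in
  [/\ inv Z l m', potential m' = potential m,
      forall p, arr m 11 p != 0 -> arr m' 11 p != 0
    & ~~ bad j -> arr m' 11 (repa j) != 0].
Proof.
move=> [[_ _ m0 _] [m7 m9 m10 _]] mj jM nsafe pZ I /=.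
rewrite mj m9 // m7 // m0.
have weaken : bad j || (arr m 11 (repa j) != 0) -> inv Z l m.
  move=> dj; case: I => I1 I2 I3 I4; split=> // t tn /I4-/(_ tn)[|h]; first by left.
  right=> k kM tk bk; have := h k kM tk bk; rewrite inE => -[/orP[/eqP e|]|].
  - by right; move: dj bk; rewrite e => /orP[->|].
  - by left.
  - by right.
have [b0|] := boolP (arr m 10 (repb j) == 0); last first.
  rewrite m10 // => bj; split=> //; first by apply: weaken; rewrite bj.
  by rewrite bj.
have bj : ~~ bad j by rewrite -m10 // b0.
have [d0|dj] := boolP (arr m 11 (repa j) == 0); last first.
  by split=> //; apply: weaken; rewrite dj orbT.
rewrite !eqxx /=.
set p := repa j; set s := src j; set c := (arr m 14 s).-1.
set m1 := set_arr (set_arr m 11 p 1) 14 s c.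
set m' := if _ then _ else _.
have E11 q : arr m' 11 q = if q == p then 1 else arr m 11 q.
  by rewrite /m'; case: ifP.
have E14 q : arr m' 14 q = if q == s then c else arr m 14 q.
  by rewrite /m'; case: ifP.
have Est : stack m' = if c == 0 then rcons (stack m) s else stack m.
  rewrite /m'; case: ifP => // _; rewrite /stack /= mkseqS eqxx; congr rcons.
  by apply/eq_in_map => q; rewrite mem_iota /= add0n; case: ltngtP.
clearbody m'.
have pM : p < M by exact: rep_lt.
have sp : src p = s by have /andP[/eqP/esym] := rep_same src a1 jM.
have sn : s < n by exact: src_lt.
case: (I) => I1 I2 I3 I4.
have lp : live m s p by rewrite /live rep_rep // sp d0 !eqxx.
have cE : arr m 14 s = c.+1.
  rewrite /c prednK // I1 // -has_count; apply/hasP.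
  by exists p; rewrite ?mem_iota.
have I1' t : t < n -> arr m' 14 t = count (live m' t) (iota 0 M).
  move=> tn; have lE : live m' t =1 (fun q => live m t q && (q != p)).
    by move=> q; rewrite /live E11; case: (eqVneq q p) => _; rewrite ?andbT ?andbF.
  rewrite (eq_count lE) E14; case: (eqVneq t s) => [->|ts].
    apply/eqP; rewrite -eqSS -cE I1 //; apply/eqP.
    by apply: count_predD1 => //; rewrite ?iota_uniq ?mem_iota.
  rewrite I1 //; apply: eq_count => q; case: (eqVneq q p) => [->|]; rewrite ?andbT //.
  by rewrite /live sp [s == t]eq_sym (negbTE ts) andbF.
have I3' q : q < M -> arr m' 11 q != 0 ->
    exists j, [/\ j < M, repa j = q, ~~ bad j & ~~ safe Z j].
  move=> qM; rewrite E11; case: (eqVneq q p) => [-> _|_]; last exact: I3.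
  by exists j; split=> //; apply: nsafe.
have I4' t : t < n -> arr m' 14 t = 0 -> t \in stack m' \/
    forall j, j < M -> tgt j = t -> ~~ bad j ->
      j \in l \/ arr m' 11 (repa j) != 0.
  move=> tn; rewrite E14 Est; case: (eqVneq t s) => [-> ->|_ /I4-/(_ tn)[h|h]].
  - by left; rewrite mem_rcons inE eqxx.
  - by left; case: ifP => // _; rewrite mem_rcons inE h orbT.
  right=> k kM tk bk; have := h k kM tk bk; rewrite inE E11 => -[/orP[/eqP->|]|].
  - by right; rewrite eqxx.
  - by left.
  - by right; case: ifP.
split=> //.
- split=> //; rewrite Est; case: eqVneq => // c0.
  rewrite all_rcons I2 andbT sn /=.
  by apply: (cnt0_notin pZ I1' I3'); rewrite ?E14 ?eqxx.
- have D m2 : \sum_(0 <= t < n) (arr m2 14 t != 0) * weight t =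
      (arr m2 14 s != 0) * weight s +
      \sum_(0 <= t < n | t != s) (arr m2 14 t != 0) * weight t.
    by rewrite (bigD1_seq s) ?iota_uniq ?mem_index_iota.
  rewrite /potential Est !D E14 eqxx cE mul1n.
  rewrite (eq_bigr (fun t => (arr m 14 t != 0) * weight t)); last first.
    by move=> t /negbTE ts; rewrite E14 ts.
  by case: (c == 0); rewrite ?big_rcons /=; lia.
- by move=> q; rewrite E11; case: ifP.
- by rewrite E11 eqxx.
Qed.

Definition scanned k m := forall j, j < k -> rw j = 0 -> ~~ bad j ->
  arr m 11 (repa j) != 0.

(** [k] counts the steps of the traversal. Until it is idle, each step lowers the list length plus
    the potential by one, from the initial value [n + M]. *)
Definition drained Z k m := [/\ ready m, scanned M m
  & exists l, [/\ chain (arr m 13) (reg m 5) l,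
      all (fun j => (j < M) && ~~ Z (tgt j)) l, inv Z l m
    & (reg m 5 = 0 /\ reg m 4 = 0) \/ size l + potential m + k <= n + M]].

Lemma exec_scan Z m : postfix Z -> ready m ->
  (forall s, s < n -> exists2 i, i < M & src i = s) ->
  reg m 4 = 0 -> reg m 5 = 0 ->
  (forall p, p < M -> arr m 11 p = 0) ->
  (forall s, s < n -> arr m 14 s =
     count (fun p => (repa p == p) && (src p == s)) (iota 0 M)) ->
  drained Z 0 (exec (for_ (Reg 2) scan_cmd) m).
Proof.
move=> pZ sm src_ex r4 r5 m11 m14.
have m14_neq0 t : t < n -> arr m 14 t != 0.
  move=> tn; rewrite m14 // -lt0n -has_count; apply/hasP.
  have [i iM it] := src_ex t tn; exists (repa i).
    by rewrite mem_iota rep_lt.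
  rewrite rep_rep // eqxx /=.
  by have /andP[/eqP <- _] := rep_same src a1 iM; rewrite it.
have I0 : inv Z [::] m.
  split; first 1 last.
  - by rewrite /stack r4.
  - by move=> p pM; rewrite m11.
  - by move=> t /m14_neq0 /eqP.
  move=> s sn; rewrite m14 //; apply: eq_in_count => p; rewrite mem_iota /= => pM.
  by rewrite /live m11 // eqxx andbT.
(* Initially no state is deleted, and each transition lies in the list of exactly one target. *)
have pot0 : potential m = n + M.
  rewrite /potential /stack r4 big_nil addn0.
  have tM : all (fun j => tgt j < n) (iota 0 M).
    by apply/allP => j; rewrite mem_iota; exact: tgt_lt.
  have -> : n + M = \sum_(0 <= t < n) 1 +
      \sum_(0 <= t < n) count (fun j => tgt j == t) (iota 0 M).
    by rewrite sum_count // size_iota sum_nat_const_nat subn0 muln1.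
  rewrite -big_split /=.
  apply: eq_big_nat => t /andP[_ tn]; rewrite m14_neq0 // mul1n add1n.
  by rewrite /weight size_rev size_filter.
have [sm' I' p' sc' r5'] : let m' := exec (for_ (Reg 2) scan_cmd) m in
    [/\ ready m', inv Z [::] m', potential m' = n + M, scanned M m' & reg m' 5 = 0].
  apply: (@for_ind (fun k m' => [/\ ready m', inv Z [::] m',
    potential m' = n + M, scanned k m' & reg m' 5 = 0])) => //.
    by case: sm => -[].
  move=> k m' kM mk [sm' I' p' sc' r5'].
  rewrite (_ : exec scan_cmd m' = if arr m' 4 (reg m' 3) == 0
    then exec process_cmd m' else m') // mk.
  have -> : arr m' 4 k = rw k by case: sm' => -[].
  case: eqVneq => [rk|rk]; last first.
    split=> // j; rewrite ltnS leq_eqVlt => /predU1P[->|]; last exact: sc'.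
    by move/eqP; rewrite (negbTE rk).
  have [||I'' p'' dm dk] := @exec_process Z k [::] m' sm' mk kM _ pZ.
  - by rewrite /safe rk andbF.
  - case: I' => I1 I2 I3 I4; split=> // t tn /I4-/(_ tn)[|h]; first by left.
    by right=> j jM tj bj; right; case: (h j jM tj bj).
  split.
  - exact: (exec_ready (c := process_cmd)).
  - exact: I''.
  - by rewrite -p' -p''.
  - move=> j; rewrite ltnS leq_eqVlt => /predU1P[-> _|jk rj bj]; first exact: dk.
    by apply: dm; apply: sc'.
  - by rewrite -[LHS]/(reg (exec process_cmd m') 5) exec_reg.
split=> //; exists [::]; split=> //.
by right; rewrite p' addn0.
Qed.

(** Popping [t] frees its weight and creates a list shorter by one; consuming a cell shortens the
    list at equal potential. The transitions into the popped state become the pending ones. *)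
Lemma exec_drain Z k m : postfix Z -> drained Z k m ->
  drained Z k.+1 (exec drain_cmd m).
Proof.
move=> pZ [sm sc [l [cl al I pot]]].
case e5 : (reg m 5) => [|j].
  have l0 : l = [::] by case: l cl {al I pot} => //= ? ? []; rewrite e5.
  subst l; rewrite [exec _ _]/= e5 /=.
  case e4 : (reg m 4) => [|t0] /=.
    by split=> //; exists [::]; split=> //; left.
  set t := arr m 15 t0; set m' := set_reg _ 5 _.
  have sE : stack m = rcons (stack m') t by rewrite /stack e4 mkseqS.
  have m'14 : arr m' 14 = arr m 14 by [].
  have m'11 : arr m' 11 = arr m 11 by [].
  case: (I) => I1 I2 I3 I4.
  move: (I2); rewrite sE all_rcons => /andP[/andP[tn nZt] I2'].
  split=> //; exists (preds t); split.
  - by case: sm => _ [_ _ _]; exact.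
  - apply/allP => i; rewrite mem_rev mem_filter mem_iota add0n => /andP[/eqP -> /= ->].
    by [].
  - split=> // t' t'n; rewrite m'14 => /I4-/(_ t'n)[|h]; last first.
      right=> i iM ti bi; rewrite m'11; right.
      by case: (h i iM ti bi).
    rewrite sE mem_rcons inE => /orP[/eqP ->|]; last by left.
    right=> i iM ti _; left.
    by rewrite mem_rev mem_filter mem_iota add0n iM ti eqxx.
  - right; case: pot => [[_]|]; first by rewrite e4.
    have -> : potential m = potential m' + weight t.
      by rewrite /potential sE big_rcons /= addnA.
    rewrite /weight; lia.
have [l' le] : exists l', l = j :: l'.
  by case: l cl {al I pot} => [|i l'] /=; rewrite e5 // => -[[->] _]; exists l'.
subst l; case: cl => _ cl; case/andP: al => /andP[jM nZj] al.
rewrite (_ : exec drain_cmd m = if reg m 5 == 0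
    then exec (If (TestEq (Reg 4) (Cst 0)) Skip
      (Seq (Assign 4 (Dec (Reg 4))) (Assign 5 (Get 12 (Get 15 (Reg 4)))))) m
    else exec process_cmd
      (set_reg (set_reg m 3 (reg m 5).-1) 5 (arr m 13 (reg m 5).-1))) // e5 [_ == 0]/=.
set m1 := set_reg _ 5 _.
have [//|//|||||I' p' dm _] := @exec_process Z j l' m1 => //.
  by rewrite /safe (negbTE nZj).
split.
- exact: (exec_ready (c := process_cmd)).
- by move=> i iM ri bi; apply: dm; apply: sc.
exists l'; split=> //.
- by rewrite exec_arr // exec_reg.
- right; case: pot => [[]|]; first by rewrite e5.
  rewrite p' -[potential m1]/(potential m) /=; lia.
Qed.

(** After [n + M] steps list and stack are empty, so nothing is pending: every non-Bad transition
    into a deleted state belongs to a dead action. Any live action of a remaining state therefore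
    witnesses the post-fixpoint property. *)
Lemma drained_idle Z m : postfix Z -> drained Z (n + M) m ->
  [/\ postfix (fun s => arr m 14 s != 0)
    & forall s, s < n -> Z s -> arr m 14 s != 0].
Proof.
move=> pZ [_ sc [l [cl _ I pot]]].
have [l0 st0] : l = [::] /\ stack m = [::].
  case: pot => [[r5 r4]|pot].
    rewrite /stack r4; split=> //.
    by case: l cl {I} => //= i l' []; rewrite r5.
  split; first by case: l pot {cl I} => //= i l'; rewrite /potential; lia.
  move: pot; rewrite /potential; case: stack => // t st.
  by rewrite big_cons /weight; lia.
subst l; split; last first.
  move=> s sn; apply: contraLR; rewrite negbK => /eqP c0.
  by case: I => I1 _ I3 _; apply: cnt0_notin pZ I1 I3 sn c0.
case: I => I1 _ _ I4 s sn; rewrite I1 // -lt0n -has_count.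
move=> /hasP[p]; rewrite mem_iota add0n => /= pM /and3P[/eqP rp /eqP sp p0].
exists p; split=> // j jM spj bj.
have rj : repa j = p by apply/eqP; rewrite -rp eq_sym rep_eq.
have live_j : ~~ (arr m 11 (repa j) != 0) by rewrite rj negbK.
apply/andP; split; apply: contra live_j.
- move=> /eqP c0; have [|] := I4 (tgt j) (tgt_lt jM) c0; first by rewrite st0.
  by move=> /(_ j jM erefl bj)[].
- by move=> /eqP r0; apply: sc.
Qed.

End Worklist.

(** * The complete program for the inner fixpoint *)

Definition nu_cmd : cmd :=
  Seq setup_cmd
 (Seq (Assign 4 (Cst 0))
 (Seq (Assign 5 (Cst 0))
 (Seq (for_ (Reg 2) scan_cmd)
 (Seq (Loop (Reg 0) drain_cmd)
 (Seq (Loop (Reg 2) drain_cmd)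
      (for_ (Reg 0) output_cmd)))))).

Lemma exec_output m n : reg m 0 = n ->
  forall s, s < n ->
    arr (exec (for_ (Reg 0) output_cmd) m) 5 s = (arr m 14 s != 0).
Proof.
move=> r0.
suff [] : let m' := exec (for_ (Reg 0) output_cmd) m in
    arr m' 14 = arr m 14 /\ forall s, s < n -> arr m' 5 s = (arr m 14 s != 0) by [].
apply: (@for_ind (fun k m' => arr m' 14 = arr m 14 /\
  forall s, s < k -> arr m' 5 s = (arr m 14 s != 0))) => // k m' kn mk [h14 h5].
rewrite /= mk h14; split=> [|s]; first by case: ifP.
rewrite ltnS leq_eqVlt.
by case: eqVneq => [-> _|sk /h5 <-]; case: (arr m 14 k == 0); rewrite /= ?eqxx ?(negbTE sk).
Qed.

Lemma exec_seq7 c1 c2 c3 c4 c5 c6 c7 m :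
  exec (Seq c1 (Seq c2 (Seq c3 (Seq c4 (Seq c5 (Seq c6 c7)))))) m =
  exec c7 (exec c6 (exec c5 (exec c4 (exec c3 (exec c2 (exec c1 m)))))).
Proof. by []. Qed.

Lemma exec_nu n M src a1 a2 tgt rw m :
  (forall i j, i <= j -> j < M -> src i <= src j) ->
  (forall i, i < M -> src i < n) -> (forall i, i < M -> tgt i < n) ->
  (forall s, s < n -> exists2 i, i < M & src i = s) ->
  reg m 0 = n -> reg m 2 = M -> arr m 0 =1 src -> arr m 1 =1 a1 ->
  arr m 2 =1 a2 -> arr m 3 =1 tgt -> arr m 4 =1 rw ->
  exists Z : pred nat,
    [/\ forall s, s < n -> arr (exec nu_cmd m) 5 s = Z s,
        postfix n M src a1 a2 tgt rw (arr m 5) Z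
      & forall Z', postfix n M src a1 a2 tgt rw (arr m 5) Z' ->
          forall s, s < n -> Z' s -> Z s].
Proof.
move=> ss sn tn sex r0 r2 h0 h1 h2 h3 h4.
have [] := exec_setup ss r0 r2 h0 h1 h2 h3 h4.
set m1 := exec setup_cmd m => rd d0 c0.
set m2 := set_reg (set_reg m1 4 0) 5 0.
pose m3 := exec (for_ (Reg 2) scan_cmd) m2.
pose m4 := iter (n + M) (exec drain_cmd) m3.
have st2 : table_ready n M src a1 a2 tgt rw (arr m 5) m2 by [].
have dr Z : postfix n M src a1 a2 tgt rw (arr m 5) Z ->
    drained n M src a1 a2 tgt rw (arr m 5) Z (n + M) m4.
  move=> pZ; rewrite /m4; elim: (n + M) => [|k IH] /=.
    exact: exec_scan.
  exact: exec_drain.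
(* The empty set is trivially a post-fixpoint and yields the facts that do not mention [Z]. *)
have dr0 := dr pred0 (fun _ _ h => False_ind _ (notF h)).
have r4 : reg m4 0 = n by case: dr0 => -[[]].
have nuE : exec nu_cmd m = exec (for_ (Reg 0) output_cmd) m4.
  rewrite [LHS](exec_seq7 setup_cmd (Assign 4 (Cst 0)) (Assign 5 (Cst 0))
    (for_ (Reg 2) scan_cmd) (Loop (Reg 0) drain_cmd) (Loop (Reg 2) drain_cmd)).
  rewrite -[exec (Assign 5 _) _]/m2 -/m3.
  have r3 : reg m3 0 = n by rewrite exec_reg //; case: st2 => -[].
  have r3' : reg m3 2 = M by rewrite exec_reg //; case: st2 => -[].
  have r3'' : reg (exec (Loop (Reg 0) drain_cmd) m3) 2 = M by rewrite exec_reg.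
  suff -> : exec (Loop (Reg 2) drain_cmd) (exec (Loop (Reg 0) drain_cmd) m3) = m4.
    by [].
  (* Two consecutive loops give |S| + |delta| steps without the machine having to add. *)
  transitivity (iter (reg (exec (Loop (Reg 0) drain_cmd) m3) 2)
    (exec drain_cmd) (iter (reg m3 0) (exec drain_cmd) m3)); first by [].
  by rewrite r3'' r3 -iterD addnC.
exists (fun s => arr m4 14 s != 0); split.
- by move=> s sn'; rewrite nuE (@exec_output _ n).
- by have [] := drained_idle tn _ dr0.
- by move=> Z' pZ; have [] := drained_idle tn pZ (dr _ pZ).
Qed.

(** * From the transition table back to the game *)

Lemma sorted_blocks (S T : eqType) (f : S -> nat) (g : T -> nat)
    (F : S -> seq T) (ss : seq S) :
  (forall s x, x \in F s -> g x = f s) -> sorted leq (map f ss) ->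
  sorted leq [seq g x | x <- [seq x | s <- ss, x <- F s]].
Proof.
move=> gF; rewrite !(sorted_pairwise leq_trans).
elim: ss => //= s ss IH /andP[/allP fs pss].
rewrite map_cat pairwise_cat IH // andbT map_id; apply/andP; split.
  apply/allrelP => _ _ /mapP[x xs ->] /mapP[y /allpairsPdep[s' [z [s's zs ->]]] ->].
  by rewrite (gF _ _ xs) (gF _ _ zs); apply: fs; apply: map_f.
have : all (fun x => g x == f s) (F s) by apply/allP => x /gF ->.
elim: (F s) => //= x xs IHx /andP[/eqP gx gxs]; rewrite IHx // andbT.
by rewrite all_map; apply: sub_all gxs => y /= /eqP ->; rewrite gx.
Qed.

Lemma map_enum_rank (T : finType) :
  [seq val (enum_rank x) | x <- enum T] = iota 0 #|T|.
Proof.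
apply: (@eq_from_nth _ 0); first by rewrite size_map size_iota cardE.
move=> i; rewrite size_map -cardE => iT; rewrite nth_iota //.
have x0 := enum_val (Ordinal iT).
rewrite (nth_map x0) -?cardE //.
by rewrite -[nth x0 (enum T) i]/(nth x0 (enum T) (Ordinal iT)) -enum_val_nth enum_valK.
Qed.

Section Link.
Variables (R : realType) (S A : finType) (G : game R S A).
Variable r : S -> A -> A -> bool.

Local Notation M := (size (transitions G)).
Local Notation src := (arr (input G r) 0).
Local Notation act1 := (arr (input G r) 1).
Local Notation act2 := (arr (input G r) 2).
Local Notation tgt := (arr (input G r) 3).
Local Notation rew := (arr (input G r) 4).

Lemma mem_transitions s a b t : ((s, a, b, t) \in transitions G) =
  [&& a \in avail1 G s, b \in avail2 G s & t \in Succ G s a b].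
Proof.
apply/allpairsPdep/and3P => [[s' [x [_ h e]]]|[aG bG tS]].
  move: h; rewrite -e => /allpairsPdep[a' [y [+ h ey]]].
  rewrite mem_enum => a'G; move: h; rewrite -ey.
  move=> /allpairsPdep[b' [t' [+ + [-> -> -> ->]]]].
  by rewrite !mem_enum.
exists s, (s, a, b, t); split=> //; first by rewrite mem_enum.
apply/allpairsPdep; exists a, (s, a, b, t); split=> //; first by rewrite mem_enum.
by apply/allpairsPdep; exists b, t; split; rewrite ?mem_enum.
Qed.

Lemma transitionP i : i < M -> exists s a b t,
  [/\ a \in avail1 G s, b \in avail2 G s & t \in Succ G s a b] /\
  [/\ src i = enum_rank s, act1 i = enum_rank a, act2 i = enum_rank b,
      tgt i = enum_rank t & rew i = r s a b].
Proof.
move=> iM; have [x0 _] : exists x0, x0 \in transitions G.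
  by case: (transitions G) iM => // x l _; exists x; rewrite mem_head.
have := mem_nth x0 iM; case e : (nth x0 _ i) => [[[s a] b] t].
rewrite mem_transitions => /and3P h; exists s, a, b, t; split=> //.
by split; rewrite /= (nth_map x0) // e.
Qed.

Lemma transition_index s a b t :
  a \in avail1 G s -> b \in avail2 G s -> t \in Succ G s a b -> exists2 i, i < M &
  [/\ src i = enum_rank s, act1 i = enum_rank a, act2 i = enum_rank b,
      tgt i = enum_rank t & rew i = r s a b].
Proof.
move=> aG bG tS; have xG : (s, a, b, t) \in transitions G.
  by rewrite mem_transitions aG bG.
exists (index (s, a, b, t) (transitions G)); first by rewrite index_mem.
by split; rewrite /= (nth_map (s, a, b, t)) ?index_mem // nth_index.
Qed.

Lemma src_lt i : i < M -> src i < #|S|.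
Proof. by move=> /transitionP[s [a [b [t [_ [-> _ _ _ _]]]]]]; exact: ltn_ord. Qed.

Lemma tgt_lt i : i < M -> tgt i < #|S|.
Proof. by move=> /transitionP[s [a [b [t [_ [_ _ _ -> _]]]]]]; exact: ltn_ord. Qed.

Lemma src_ex k : k < #|S| -> exists2 i, i < M & src i = k.
Proof.
move=> kS; pose s := enum_val (Ordinal kS).
have [[a aG] [b bG]] := (avail1_ex G s, avail2_ex G s).
have [t tS] := Succ_ex aG bG; have [i iM [si _ _ _ _]] := transition_index aG bG tS.
by exists i; rewrite // si enum_valK.
Qed.

Lemma src_sorted i j : i <= j -> j < M -> src i <= src j.
Proof.
move=> ij jM; rewrite -[src i]/(nth 0 [seq val (enum_rank x.1.1.1) | x <- transitions G] i).
rewrite -[src j]/(nth 0 [seq val (enum_rank x.1.1.1) | x <- transitions G] j).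
apply: (sorted_leq_nth leq_trans leqnn) => //; last first.
- by rewrite inE size_map.
- by rewrite inE size_map (leq_ltn_trans ij).
apply: (@sorted_blocks _ _ (fun s => val (enum_rank s))).
  move=> s x /allpairsPdep[a [y [_ /allpairsPdep[b [t [_ _ ->]]] ->]]].
  by [].
by rewrite map_enum_rank iota_sorted.
Qed.

Lemma enum_rank_val_inj (T : finType) (x y : T) :
  (enum_rank x : nat) = enum_rank y -> x = y.
Proof. by move=> /val_inj/enum_rank_inj. Qed.

Variables (Y : {set S}) (m : memory).
Hypothesis enc : encodes G r Y m.

Local Notation bad' := (bad_round M src act2 tgt (arr m 5)).

Lemma badP j s b : j < M -> src j = enum_rank s -> act2 j = enum_rank b ->
  b \in avail2 G s -> bad' j = (b \in Bad2 G s [set: S]%SET Y).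
Proof.
case: enc => _ _ encY jM sj bj bG; apply/hasP/idP => [[k]|].
  rewrite mem_iota add0n => /andP[_ kM]; rewrite rep_eq // => /andP[/andP[/eqP sk /eqP bk]].
  have [s' [a [b' [t [[aG bG' tS] [s'k _ b'k tk _]]]]]] := transitionP kM.
  have ? : s' = s by apply: enum_rank_val_inj; rewrite -s'k sk sj.
  have ? : b' = b by apply: enum_rank_val_inj; rewrite -b'k bk bj.
  subst s' b'; rewrite tk encY eqb0 negbK => tY.
  rewrite inE bG; apply/exists_inP; exists a.
    by rewrite inE aG; apply/forall_inP => *; exact: finset.subsetT.
  by apply/set0Pn; exists t; rewrite inE tS.
rewrite inE bG => /exists_inP[a]; rewrite inE => /andP[aG _] /set0Pn[t].
rewrite inE => /andP[tS tY].
have [k kM [sk _ bk tk _]] := transition_index aG bG tS.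
exists k; first by rewrite mem_iota.
by rewrite rep_eq // /same sk sj bk bj !eqxx tk encY tY.
Qed.

Local Notation postfix' := (postfix #|S| M src act1 act2 tgt rew (arr m 5)).

Lemma postfix_ASP (Z : {set S}) : Z \subset ASP G r [set: S]%SET Y Z ->
  postfix' (fun k => [exists s in Z, (enum_rank s : nat) == k]).
Proof.
move=> /fintype.subsetP ZA k kS /exists_inP[s /ZA + /eqP sk].
rewrite inE => /set0Pn[a]; rewrite !inE => /andP[/andP[aG _] /forall_inP good].
have [b bG] := avail2_ex G s; have [t tS] := Succ_ex aG bG.
have [i iM [si ai _ _ _]] := transition_index aG bG tS.
exists i; split=> //; first by rewrite si.
move=> j jM /andP[/eqP sij /eqP aij] bj.
have [s' [a' [b' [t' [[aG' bG' tS'] [sj aj b'j tj rj]]]]]] := transitionP jM.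
have ? : s' = s by apply: enum_rank_val_inj; rewrite -sj -sij si.
have ? : a' = a by apply: enum_rank_val_inj; rewrite -aj -aij ai.
subst s' a'; move: bj; rewrite (badP jM sj b'j bG') => bj.
have /good/andP[/fintype.subsetP/(_ t' tS') tZ rab] :
  b' \in avail2 G s :\: Bad2 G s [set: S]%SET Y by rewrite inE bj.
rewrite /safe rj rab andbT; apply/exists_inP; exists t' => //.
by rewrite tj.
Qed.

Lemma ASP_postfix (Z : pred nat) : postfix' Z ->
  [set s | Z (enum_rank s)]%SET \subset
    ASP G r [set: S]%SET Y [set s | Z (enum_rank s)]%SET.
Proof.
set ZS := [set s | _]%SET => pZ; apply/fintype.subsetP => s; rewrite inE => Zs.
have [i [iM si iP]] := pZ _ (ltn_ord _) Zs.
have [s' [a [b [t [[aG bG tS] [s'i ai bi ti ri]]]]]] := transitionP iM.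
have ? : s' = s by apply: enum_rank_val_inj; rewrite -s'i si.
subst s'; rewrite inE; apply/set0Pn; exists a; rewrite !inE aG /=.
apply/andP; split.
  by apply/forall_inP => *; exact: finset.subsetT.
apply/forall_inP => b'; rewrite inE => /andP[nb bG'].
have H t' : t' \in Succ G s a b' -> (t' \in ZS) && r s a b'.
  move=> tS'; have [j jM [sj aj bj tj rj]] := transition_index aG bG' tS'.
  have := iP j jM; rewrite /same si sj ai aj !eqxx (badP jM sj bj bG').
  by move=> /(_ isT nb) /andP[]; rewrite inE tj rj eqb0 negbK => -> ->.
(* Rewards are recorded at transitions only, so a successor is needed to read off the reward of a
   pair of actions. *)
have [t' /H/andP[_ ->]] := Succ_ex aG bG'; rewrite andbT.
by apply/fintype.subsetP => t'' /H/andP[].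
Qed.

Lemma nu_cmd_correct : encodes G r (nuZ G r Y) (exec nu_cmd m).
Proof.
case: (enc) => encr enca _; split=> [x x3|k i k5|s].
- by rewrite exec_reg -?encr //; case: x x3 => [|[|[]]].
- by rewrite exec_arr -?enca //; case: k k5 => [|[|[|[|[]]]]].
have [] := @exec_nu #|S| M src act1 act2 tgt rew m.
- exact: src_sorted.
- exact: src_lt.
- exact: tgt_lt.
- exact: src_ex.
- by rewrite encr.
- by rewrite encr.
- by move=> i; rewrite enca.
- by move=> i; rewrite enca.
- by move=> i; rewrite enca.
- by move=> i; rewrite enca.
- by move=> i; rewrite enca.
move=> Z [Z5 /ASP_postfix/nuZ_max/fintype.subsetP Znu Zmax].
rewrite Z5; last exact: ltn_ord.
(* The computed set is a post-fixpoint, hence below the greatest one; conversely it contains every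
   post-fixpoint, in particular [nuZ G r Y]. *)
congr nat_of_bool; apply/idP/idP => [Zs|sN]; first by apply: Znu; rewrite inE.
apply: (Zmax (fun k => [exists s in nuZ G r Y, (enum_rank s : nat) == k])).
- by apply: postfix_ASP; rewrite nuZ_fix.
- exact: ltn_ord.
- by apply/exists_inP; exists s.
Qed.

End Link.

(** Every state is the source of a transition, so that passes over the states also fit into time
    O(|delta|). *)
Lemma card_le_transitions (R : realType) (S A : finType) (G : game R S A)
    (r : S -> A -> A -> bool) : #|S| <= size (transitions G).
Proof.
have : {subset iota 0 #|S| <= [seq arr (input G r) 0 i | i <- iota 0 (size (transitions G))]}.
  move=> k; rewrite mem_iota => /(src_ex G r)[i iM <-].
  by apply: map_f; rewrite mem_iota.
by move=> /(uniq_leq_size (iota_uniq 0 _)); rewrite size_map !size_iota.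
Qed.

Lemma Ystar_quadratic_time (R : realType) :
  exists (nu : cmd) (C : nat),
    forall (S A : finType) (G : game R S A) (r : S -> A -> A -> bool),
      (forall (Y : {set S}) (m : memory), encodes G r Y m ->
         exists (t : nat) (m' : memory),
           run nu m t m' /\ encodes G r (nuZ G r Y) m') /\
      (exists (t : nat) (m' : memory),
         [/\ run (mu_loop nu) (input G r) t m',
             encodes G r (Ystar G r) m'
           & (t <= C * (#|S| * delta_size G).+1)%N]).
Proof.
(* One round takes at most [cmd_size nu_cmd * M.+1] steps. The factor 2 absorbs the successor, as
   |S| <= [M]; the summand 2 pays for entering and leaving the outer loop. *)
exists nu_cmd, (2 * cmd_size nu_cmd + 2) => S A G r.
set M := size (transitions G).
have nuP (Y : {set S}) m : encodes G r Y m ->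
    runs nu_cmd m (cmd_size nu_cmd * M.+1) (exec nu_cmd m).
  case=> encr _ _; apply: runs_single_pass => //.
    by rewrite encr //; exact: card_le_transitions.
  by rewrite encr.
split=> [Y m enc|].
  have [t _ rt] := nuP _ _ enc.
  by exists t, (exec nu_cmd m); split=> //; exact: nu_cmd_correct.
have H k Y m : encodes G r Y m -> exists m',
    runs (iter k (Seq nu_cmd) Skip) m (k * (cmd_size nu_cmd * M.+1) + 1) m' /\
    encodes G r (iter k (nuZ G r) Y) m'.
  elim: k Y m => [|k IH] Y m enc.
    by exists m; split=> //; exists 1 => //; constructor.
  have [m' [run' enc']] := IH _ _ (nu_cmd_correct enc).
  exists m'; rewrite mulSn -addnA; split; last by rewrite iterSr.
  by apply: runs_seq run'; exact: nuP enc.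
have [m' [[t tT rt] enc']] := H #|S| _ _ (encodes_input G r).
exists t.+1, m'; split=> //.
  exact: RunLoop.
have := card_le_transitions G r; rewrite -size_transitions -/M.
move: tT; set c := cmd_size nu_cmd; set n := #|S|; clearbody c n M; nia.
Qed.

Local Open Scope classical_set_scope.
Local Open Scope ring_scope.

(** * Measures of events on plays *)

Section LimSup.
Variables (R : realType) (u : nat -> R).
Hypothesis u01 : forall n, 0 <= u n <= 1.

Let bounded_u : bounded_fun (u : R^o ^nat).
Proof.
exists 1; split; first exact: num_real.
move=> x x1 n _ /=; have /andP[u0 u1] := u01 n.
by rewrite ger0_norm //; apply: le_trans u1 (ltW x1).
Qed.

Let drop_neq0 n : sdrop u n !=set0.
Proof. by exists (u n), n => /=. Qed.

Let drop_ub n : has_ubound (sdrop u n).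
Proof. by exists 1 => _ [k _ <-]; case/andP: (u01 k). Qed.

Let drop_lb n : has_lbound (sdrop u n).
Proof. by exists 0 => _ [k _ <-]; case/andP: (u01 k). Qed.

(** All quantifiers range over natural numbers, which makes the objectives measurable. The tolerance
    is there because the terms may approach [a] from below. *)
Lemma limn_sup_geP (a : R) : a <= limn_sup u <->
  forall k n, exists2 m, (n <= m)%N & a - k.+1%:R^-1 <= u m.
Proof.
rewrite limn_supE //; split=> [al k n|H].
  have lbs : has_lbound (range (sups u)).
    exists 0 => _ [j _ <-]; apply: le_trans (_ : u j <= _).
      by case/andP: (u01 j).
    by apply: ub_le_sup => //; exists j => /=.
  have an : a <= sup (sdrop u n).
    by apply: le_trans al _; apply: ge_inf => //; exists n.
  have k0 : 0 < k.+1%:R^-1 :> R by rewrite invr_gt0 ltr0n.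
  have [_ [m nm <-] um] := sup_adherent k0 (conj (drop_neq0 n) (drop_ub n)).
  by exists m => //; apply: ltW; apply: le_lt_trans um; rewrite lerD2r.
apply: lb_le_inf; first by exists (sups u 0%N), 0%N.
move=> _ [n _ <-]; apply/ler_addgt0Pr => e e0.
have [k ke] : exists k : nat, k.+1%:R^-1 < e.
  by have [k _ ke] := near_infty_natSinv_lt (PosNum e0); exists k; apply: ke => /=.
have [m nm am] := H k n.
rewrite -lerBlDr; apply: le_trans (_ : u m <= _); last first.
  by apply: ub_le_sup => //; exists m.
by apply: le_trans am; rewrite lerD2l lerN2 ltW.
Qed.

Lemma limn_inf_geP (a : R) : a <= limn_inf u <->
  forall k, exists n, forall m, (n <= m)%N -> a - k.+1%:R^-1 <= u m.
Proof.
rewrite limn_infE //.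
have ub : has_ubound (range (infs u)).
  exists 1 => _ [j _ <-]; apply: le_trans (_ : u j <= _).
    by apply: ge_inf => //; exists j => /=.
  by case/andP: (u01 j).
split=> [al k|H].
  have k0 : 0 < k.+1%:R^-1 :> R by rewrite invr_gt0 ltr0n.
  have [|_ [n _ <-] un] := @sup_adherent _ (range (infs u)) _ k0.
    by split=> //; exists (infs u 0%N), 0%N.
  exists n => m nm; apply: le_trans (_ : infs u n <= _).
    by apply: ltW; apply: le_lt_trans un; rewrite lerD2r.
  by apply: ge_inf => //; exists m.
apply/ler_addgt0Pr => e e0.
have [k ke] : exists k : nat, k.+1%:R^-1 < e.
  by have [k _ ke] := near_infty_natSinv_lt (PosNum e0); exists k; apply: ke => /=.
have [n an] := H k.
rewrite -lerBlDr; apply: le_trans (_ : infs u n <= _); last first.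
  by apply: ub_le_sup => //; exists n.
apply: lb_le_inf => // _ [m nm <-]; apply: le_trans (an m nm).
by rewrite lerD2l lerN2 ltW.
Qed.

Lemma limn_inf_le_sup : limn_inf u <= limn_sup u.
Proof.
apply/limn_sup_geP => k n; have /limn_inf_geP/(_ k)[n' h] := lexx (limn_inf u).
by exists (maxn n n'); [exact: leq_maxl|apply: h; exact: leq_maxr].
Qed.

End LimSup.

(** * Events on finite prefixes and their probabilities *)

Section PlayMeasure.
Variables (R : realType) (S A : finType) (G : game R S A).
Variables (s0 : S) (sigma1 : strategy1 G) (sigma2 : strategy2 G).

Local Notation T := (round S A).
Local Notation play := (infseq_meas (round0 G s0)).
Local Notation Pr := (play_prob s0 sigma1 sigma2).
Local Notation cyl := (cylinder (round0 G s0)).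
Local Notation cp := (cylinder_prob s0 sigma1 sigma2).

Lemma measurable_cylinder h : measurable (cyl h : set play).
Proof. by apply: sub_sigma_algebra; exists h. Qed.

(** There are finitely many words of length [n], so the event is a finite union of cylinders,
    whatever [Q] is. *)
Lemma measurable_prefix n (Q : set (seq T)) :
  measurable ([set w | Q (mkseq w n)] : set play).
Proof.
have -> : [set w : play | Q (mkseq w n)] =
    \bigcup_(h : n.-tuple T) (cyl h `&` [set _ | Q h]).
  apply/seteqP; split => [w Qw|w [h _ [wh Qh]]].
    exists (Tuple (introT eqP (size_mkseq w n))) => //; split=> //=.
    by rewrite /cylinder /= size_mkseq.
  by move: wh; rewrite /cylinder /= size_tuple => ->.
apply: fin_bigcup_measurable => // h _.
have [Qh|Qh] := pselect (Q h).
  rewrite (_ : [set _ | _] = setT) ?setIT; first exact: measurable_cylinder.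
  by apply/seteqP; split.
rewrite (_ : [set _ | _] = set0) ?setI0 //.
by apply/seteqP; split.
Qed.

Lemma cp_ge0 h : 0 <= cp h.
Proof. by rewrite -lee_fin -play_probE. Qed.

Lemma Pr_cylinder_split h (B : set play) : measurable B ->
  Pr (cyl h `&` B) = (\sum_x Pr (cyl (rcons h x) `&` B))%E.
Proof.
move=> mB; have -> : cyl h `&` B = \bigcup_(x : T) (cyl (rcons h x) `&` B).
  apply/seteqP; split => [w [wh Bw]|w [x _ []]].
    exists (w (size h)) => //; split=> //; move: wh.
    by rewrite /cylinder /= size_rcons mkseqS => ->.
  rewrite /cylinder /= size_rcons mkseqS => /eqP.
  by rewrite eqseq_rcons => /andP[/eqP].
rewrite measure_fin_bigcup //.
- rewrite (fsbigE (index_enum T)) ?index_enum_uniq //.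
    by apply: eq_bigl => x; rewrite in_setT.
  by move=> x _; rewrite mem_index_enum.
- exact: finite_finset.
- move=> x y _ _ [w [[+ _] [+ _]]]; rewrite /cylinder /= !size_rcons !mkseqS.
  move=> /eqP; rewrite eqseq_rcons => /andP[_ /eqP ->] /eqP.
  by rewrite eqseq_rcons => /andP[_ /eqP].
- by move=> x _; apply: measurableI => //; exact: measurable_cylinder.
Qed.

(** A sum over all extensions of [h] by [n] rounds. With a factor [cp] it is an integral over the
    cylinder of [h], so expectations are handled as finite sums. *)
Fixpoint ext_sum n (f : seq T -> R) h : R :=
  if n is n'.+1 then \sum_x ext_sum n' f (rcons h x) else f h.

Lemma ext_sum_le n f g h : (forall k, f k <= g k) -> ext_sum n f h <= ext_sum n g h.
Proof. by move=> fg; elim: n h => //= n IH h; apply: ler_sum => x _. Qed.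

Lemma ext_sumZ n c f h : ext_sum n (fun g => c * f g) h = c * ext_sum n f h.
Proof.
elim: n h => //= n IH h; rewrite mulr_sumr.
by apply: eq_bigr => x _.
Qed.

Lemma ext_sumS n f h :
  ext_sum n.+1 f h = ext_sum n (fun g => \sum_x f (rcons g x)) h.
Proof.
elim: n h => // n IH h; rewrite -[LHS]/(\sum_x ext_sum n.+1 f (rcons h x)) [RHS]/=.
by apply: eq_bigr => x _; exact: IH.
Qed.

(** The iterated one-step inequality of a supermartingale with decay factor [c]. *)
Lemma ext_sum_geometric c f n h : 0 <= c ->
  (forall g, \sum_x f (rcons g x) <= c * f g) -> ext_sum n f h <= c ^+ n * f h.
Proof.
move=> c0 fc; elim: n h => [h|n IH h]; first by rewrite mul1r.
rewrite ext_sumS; apply: le_trans (ext_sum_le _ _ fc) _.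
by rewrite ext_sumZ exprS -mulrA ler_wpM2l.
Qed.

Lemma Pr_prefix n (Q : pred (seq T)) h :
  Pr (cyl h `&` [set w | Q (mkseq w (size h + n))]) =
  (ext_sum n (fun g => (Q g)%:R * cp g) h)%:E.
Proof.
elim: n h => [|n IH] h.
  rewrite addn0 /=; case Qh : (Q h).
    rewrite mul1r -play_probE; congr (Pr _).
    by apply/seteqP; split => [w []//|w wh]; split=> //=; rewrite wh.
  rewrite mul0r (_ : _ `&` _ = set0) ?measure0 //.
  by apply/seteqP; split => // w [wh] /=; rewrite wh Qh.
rewrite Pr_cylinder_split; last exact: (measurable_prefix _ (fun g => Q g)).
rewrite /= -sumEFin; apply: eq_bigr => x _; rewrite -IH.
by rewrite size_rcons addSnnS.
Qed.

Lemma Pr_prefix0 n (Q : pred (seq T)) :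
  Pr [set w | Q (mkseq w n)] = (ext_sum n (fun g => (Q g)%:R * cp g) [::])%:E.
Proof.
rewrite -Pr_prefix; congr (Pr _); apply/seteqP; split => [w|w []] //.
Qed.

(** A null set outside of which every sequence is consistent with the game: prefixes of positive
    probability only use actions and successors of positive probability. *)
Definition null_plays : set play := \bigcup_n [set w | cp (mkseq w n) == 0].

Lemma measurable_null_plays : measurable null_plays.
Proof.
apply: bigcupT_measurable => n.
exact: (measurable_prefix _ (fun g => cp g == 0)).
Qed.

Lemma null_playsE : Pr null_plays = 0%E.
Proof.
apply/negligibleP; first exact: measurable_null_plays.
apply: negligible_bigcup => n; apply/negligibleP.
  exact: (measurable_prefix _ (fun g => cp g == 0)).
apply: etrans (Pr_prefix0 n (fun g => cp g == 0)) _; congr EFin; elim: n [::] => [h|n IH h] /=.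
  by case: eqVneq => [->|]; rewrite ?mulr0 ?mul0r.
by rewrite big1.
Qed.

Lemma cp_avail h s a b : cp (rcons h (s, a, b)) != 0 ->
  [/\ cp h != 0, 0 < state_prob G s0 h s, 0 < sigma1 h s a & 0 < sigma2 h s b].
Proof.
move=> h0; have : 0 < cp (rcons h (s, a, b)) by rewrite lt_def h0 cp_ge0.
have [p1 _] := choice_dist sigma1 h s; have [p2 _] := choice_dist sigma2 h s.
move: h0; rewrite cylinder_prob_rcons /round_prob !mulf_eq0 !negb_or -!andbA.
move=> /and4P[c0 st0 a0 b0]; have a_gt0 : 0 < sigma1 h s a by rewrite lt_def a0 p1.
have b_gt0 : 0 < sigma2 h s b by rewrite lt_def b0 p2.
have c_gt0 : 0 < cp h by rewrite lt_def c0 cp_ge0.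
by rewrite !mulrA pmulr_lgt0 // pmulr_lgt0 // pmulr_rgt0.
Qed.

Lemma strategy_avail1 h s a : 0 < sigma1 h s a -> a \in avail1 G s.
Proof. by apply: contraTT => /choice_avail ->; rewrite ltxx. Qed.

Lemma strategy_avail2 h s b : 0 < sigma2 h s b -> b \in avail2 G s.
Proof. by apply: contraTT => /choice_avail ->; rewrite ltxx. Qed.

Lemma measurable_is_play : measurable ([set w | is_play G w] : set play).
Proof.
pose Q n (g : seq T) := let: (s, a, b) := nth (round0 G s0) g n in
  [/\ a \in avail1 G s, b \in avail2 G s
    & (nth (round0 G s0) g n.+1).1.1 \in Succ G s a b].
have -> : [set w : play | is_play G w] = \bigcap_n [set w | Q n (mkseq w n.+2)].
  apply/seteqP; split => [w wp n _|w wp n].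
    by rewrite /mkset /Q !nth_mkseq //; exact: wp.
  by have := wp n I; rewrite /mkset /Q !nth_mkseq.
by apply: bigcapT_measurable => n; exact: (measurable_prefix _ (Q n)).
Qed.

Lemma not_null_is_play : ~` null_plays `<=` [set w | is_play G w].
Proof.
move=> w wN n; have N m : cp (mkseq w m) != 0.
  by apply/negP => m0; apply: wN; exists m.
have := N n.+2; rewrite mkseqS; case wn1 : (w n.+1) => [[s' a'] b'].
move=> /cp_avail[]; rewrite mkseqS; case wn : (w n) => [[s a] b].
move=> /cp_avail[_ _ a0 b0] s'0 _ _; split.
- exact: strategy_avail1 a0.
- exact: strategy_avail2 b0.
by move: s'0; rewrite /state_prob rev_rcons inE.
Qed.

End PlayMeasure.

(** * Measurability of the objectives, and the equalities from two inclusions *)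

Section Rewards.
Variables (R : realType) (S A : finType) (G : game R S A).
Variable r : S -> A -> A -> bool.

Local Notation T := (round S A).

Definition zeros (g : seq T) : nat := count (fun x => ~~ r x.1.1 x.1.2 x.2) g.

Lemma zeros_rcons g x : zeros (rcons g x) = (zeros g + ~~ r x.1.1 x.1.2 x.2)%N.
Proof. by rewrite /zeros -cats1 count_cat /= addn0. Qed.

Lemma zeros_le w n : (zeros (mkseq w n) <= n)%N.
Proof. by rewrite -{2}(size_mkseq w n) count_size. Qed.

Lemma avg_rewardE w n :
  avg_reward R r w n = (n%:R - (zeros (mkseq w n))%:R) / n%:R.
Proof.
rewrite /avg_reward; congr (_ / _); elim: n => [|n IH].
  by rewrite big_ord0 subr0.
rewrite big_ord_recr IH mkseqS zeros_rcons [nat_of_ord _]/=; case: (w n) => -[s a] b /=.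
by case: (r s a b); rewrite /= ?addn0 ?addn1 -?natr1 /=; ring.
Qed.

Lemma avg_reward01 w n : 0 <= avg_reward R r w n <= 1.
Proof.
rewrite avg_rewardE; case: n => [|n]; first by rewrite invr0 mulr0 lexx ler01.
rewrite divr_ge0 ?ler0n ?subr_ge0 ?ler_nat ?zeros_le //=.
by rewrite ler_pdivrMr ?ltr0n // mul1r gerBl ler0n.
Qed.

Lemma measurable_avg_reward s0 n (B : set R) :
  measurable ([set w | B (avg_reward R r w n)] : set (infseq_meas (round0 G s0))).
Proof.
pose Q g := B ((n%:R - (zeros g)%:R) / n%:R).
rewrite (_ : [set w | _] = [set w | Q (mkseq w n)]).
  exact: (measurable_prefix n Q).
by apply/seteqP; split => w; rewrite /mkset avg_rewardE.
Qed.

Lemma measurable_at_least_inf s0 a :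
  measurable (at_least G (LimInfAvg R r) a : set (infseq_meas (round0 G s0))).
Proof.
rewrite (_ : at_least _ _ _ = [set w : infseq_meas (round0 G s0) | is_play G w] `&`
  \bigcap_k \bigcup_n \bigcap_m [set w : infseq_meas (round0 G s0) |
    [set x | (n <= m)%N -> a - k.+1%:R^-1 <= x] (avg_reward R r w m)]).
  apply: measurableI; first exact: measurable_is_play.
  apply: bigcapT_measurable => k; apply: bigcupT_measurable => n.
  by apply: bigcapT_measurable => m; exact: measurable_avg_reward.
apply/seteqP; split => w [wp H]; split=> //.
  move=> k _; have [n nP] := (limn_inf_geP (avg_reward01 w) a).1 H k.
  by exists n => // m _; exact: nP.
apply/(limn_inf_geP (avg_reward01 w)) => k; have [n _ nP] := H k I.
by exists n => m; exact: nP.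
Qed.

Lemma measurable_at_least_sup s0 a :
  measurable (at_least G (LimSupAvg R r) a : set (infseq_meas (round0 G s0))).
Proof.
rewrite (_ : at_least _ _ _ = [set w : infseq_meas (round0 G s0) | is_play G w] `&`
  \bigcap_k \bigcap_n \bigcup_m [set w : infseq_meas (round0 G s0) |
    [set x | (n <= m)%N /\ a - k.+1%:R^-1 <= x] (avg_reward R r w m)]).
  apply: measurableI; first exact: measurable_is_play.
  apply: bigcapT_measurable => k; apply: bigcapT_measurable => n.
  by apply: bigcupT_measurable => m; exact: measurable_avg_reward.
apply/seteqP; split => w [wp H]; split=> //.
  move=> k _ n _; have [m nm mP] := (limn_sup_geP (avg_reward01 w) a).1 H k n.
  by exists m.
apply/(limn_sup_geP (avg_reward01 w)) => k n; have [m _ [nm mP]] := H k I n I.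
by exists m.
Qed.

Lemma less_thanE (L : (nat -> T) -> R) a :
  less_than G L a = [set w | is_play G w] `\` at_least G L a.
Proof.
apply/seteqP; split => w [wp wL]; split => //.
  by case=> _; rewrite leNgt wL.
by rewrite ltNge; apply/negP => ?; apply: wL.
Qed.

Lemma measurable_less_than s0 (L : (nat -> T) -> R) a :
  measurable (at_least G L a : set (infseq_meas (round0 G s0))) ->
  measurable (less_than G L a : set (infseq_meas (round0 G s0))).
Proof.
by move=> mL; rewrite less_thanE; apply: measurableD => //; exact: measurable_is_play.
Qed.

Lemma subset_Positive1 (P Q : set (nat -> T)) :
  (forall s0, measurable (P : set (infseq_meas (round0 G s0)))) ->
  (forall s0, measurable (Q : set (infseq_meas (round0 G s0)))) ->
  P `<=` Q -> Positive1 G P `<=` Positive1 G Q.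
Proof.
move=> mP mQ PQ s [sigma1 s1P]; exists sigma1 => sigma2.
by apply: lt_le_trans (s1P sigma2) _; apply: le_measure; rewrite ?inE.
Qed.

Lemma subset_Almost2 (P Q : set (nat -> T)) :
  (forall s0, measurable (P : set (infseq_meas (round0 G s0)))) ->
  (forall s0, measurable (Q : set (infseq_meas (round0 G s0)))) ->
  P `<=` Q -> Almost2 G P `<=` Almost2 G Q.
Proof.
move=> mP mQ PQ s [sigma2 s2P]; exists sigma2 => sigma1.
apply/eqP; rewrite eq_le; apply/andP; split; first exact: probability_le1.
rewrite -[X in (X <= _)%E](s2P sigma1).
by apply: le_measure; rewrite ?inE.
Qed.

(** Played against each other, the two strategies would give positive probability to an event
    disjoint from one of probability 1. *)
Lemma Positive1_Almost2 (L : (nat -> T) -> R) a s :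
  (forall s0, measurable (at_least G L a : set (infseq_meas (round0 G s0)))) ->
  Positive1 G (at_least G L a) s -> Almost2 G (less_than G L a) s -> False.
Proof.
move=> mL [sigma1 s1P] [sigma2 s2P].
have := s1P sigma2; rewrite ltNge => /negP; apply.
rewrite -(measure0 (play_prob s sigma1 sigma2)).
have := probability_setC (play_prob s sigma1 sigma2)
  (measurable_less_than (mL s)).
rewrite s2P subee // measure0 => <-; apply: le_measure; rewrite ?inE //.
  by apply: measurableC; exact: measurable_less_than.
by rewrite less_thanE => w Lw [_]; apply.
Qed.

Lemma at_least_inf_sup a :
  at_least G (LimInfAvg R r) a `<=` at_least G (LimSupAvg R r) a.
Proof.
move=> w [wp aw]; split=> //; apply: le_trans aw _.
exact: limn_inf_le_sup (avg_reward01 w).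
Qed.

Lemma less_than_sup_inf a :
  less_than G (LimSupAvg R r) a `<=` less_than G (LimInfAvg R r) a.
Proof.
move=> w [wp aw]; split=> //; apply: le_lt_trans aw.
exact: limn_inf_le_sup (avg_reward01 w).
Qed.

Lemma at_least_le (L : (nat -> T) -> R) a b : b <= a ->
  at_least G L a `<=` at_least G L b.
Proof. by move=> ba w [wp aw]; split=> //; apply: le_trans aw. Qed.

Lemma less_than_le (L : (nat -> T) -> R) a b : a <= b ->
  less_than G L a `<=` less_than G L b.
Proof. by move=> ab w [wp aw]; split=> //; apply: lt_le_trans ab. Qed.

(** The hypotheses are the strongest claims for both players. Monotonicity of the events gives one
    inclusion of each equality, and [Positive1_Almost2] the other. *)
Lemma determinacy_from_inclusions (Y : {set S}) :
  [set s | s \in Y] `<=` Positive1 G (at_least G (LimInfAvg R r) 1) ->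
  (forall s, s \notin Y -> exists2 c : R, 0 < c &
     Almost2 G (less_than G (LimSupAvg R r) (1 - c)) s) ->
  [/\ [set s | s \in Y] = Positive1 G (at_least G (LimInfAvg R r) 1),
      [set s | s \in Y] = Positive1 G (at_least G (LimSupAvg R r) 1),
      [set s | s \in Y] = \bigcap_(e in [set e : R | 0 < e])
              Positive1 G (at_least G (LimInfAvg R r) (1 - e))
    & [set s | s \in Y] = \bigcap_(e in [set e : R | 0 < e])
              Positive1 G (at_least G (LimSupAvg R r) (1 - e))] /\
  [/\ ~` [set s | s \in Y] = Almost2 G (less_than G (LimInfAvg R r) 1),
      ~` [set s | s \in Y] = Almost2 G (less_than G (LimSupAvg R r) 1),
      ~` [set s | s \in Y] = \bigcup_(c in [set c : R | 0 < c])
                 Almost2 G (less_than G (LimInfAvg R r) (1 - c))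
    & ~` [set s | s \in Y] = \bigcup_(c in [set c : R | 0 < c])
                 Almost2 G (less_than G (LimSupAvg R r) (1 - c))].
Proof.
move=> posY almY.
have mI a s0 := @measurable_at_least_inf s0 a.
have mS a s0 := @measurable_at_least_sup s0 a.
have mI' a s0 := measurable_less_than (mI a s0).
have mS' a s0 := measurable_less_than (mS a s0).
pose PI a := Positive1 G (at_least G (LimInfAvg R r) a).
pose PS a := Positive1 G (at_least G (LimSupAvg R r) a).
pose AI a := Almost2 G (less_than G (LimInfAvg R r) a).
pose AS a := Almost2 G (less_than G (LimSupAvg R r) a).
have PIS a : PI a `<=` PS a by apply: subset_Positive1 => //; exact: at_least_inf_sup.
have ASI a : AS a `<=` AI a by apply: subset_Almost2 => //; exact: less_than_sup_inf.
have PIe e : 0 < e -> PI 1 `<=` PI (1 - e).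
  by move=> e0; apply: subset_Positive1 => //; apply: at_least_le; lra.
have PSe e : 0 < e -> PS 1 `<=` PS (1 - e).
  by move=> e0; apply: subset_Positive1 => //; apply: at_least_le; lra.
have AIc c : 0 < c -> AI (1 - c) `<=` AI 1.
  by move=> c0; apply: subset_Almost2 => //; apply: less_than_le; lra.
have ASc c : 0 < c -> AS (1 - c) `<=` AS 1.
  by move=> c0; apply: subset_Almost2 => //; apply: less_than_le; lra.
have PAI a s : PI a s -> ~ AI a s by move=> /(Positive1_Almost2 (mI a)).
have PAS a s : PS a s -> ~ AS a s by move=> /(Positive1_Almost2 (mS a)).
have almY' s : ~ s \in Y -> exists2 c : R, 0 < c & AS (1 - c) s.
  by move=> /negP /almY.
split; split; apply/seteqP; split=> s.
- exact: posY.
- move=> Ps; apply: contrapT => /almY'[c c0 As].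
  exact: PAI Ps (AIc c c0 s (ASI _ _ As)).
- by move=> /posY /PIS.
- move=> Ps; apply: contrapT => /almY'[c c0 As].
  exact: PAS Ps (ASc c c0 s As).
- by move=> /posY Ps e e0; exact: PIe Ps.
- move=> Ps; apply: contrapT => /almY'[c c0 As].
  exact: PAI (Ps c c0) (ASI _ _ As).
- by move=> /posY Ps e e0; apply: PIS; exact: PIe Ps.
- move=> Ps; apply: contrapT => /almY'[c c0 As].
  exact: PAS (Ps c c0) As.
- by move=> /almY'[c c0 As]; exact: AIc (ASI _ _ As).
- by move=> As /posY Ps; exact: PAI Ps As.
- by move=> /almY'[c c0 As]; exact: ASc As.
- by move=> As /posY/PIS Ps; exact: PAS Ps As.
- by move=> /almY'[c c0 As]; exists c => //; exact: ASI.
- by move=> [c c0 As] /posY Ps; exact: PAI (PIe c c0 s Ps) As.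
- by move=> /almY'[c c0 As]; exists c.
- by move=> [c c0 As] /posY/PIS Ps; exact: PAS (PSe c c0 s Ps) As.
Qed.

End Rewards.

(** * Player 2 wins almost surely outside the fixpoint *)

Section Distributions.
Variables (R : realType) (T : finType).

Definition uniform (D : {set T}) (x : T) : R := (x \in D)%:R / #|D|%:R.

Lemma uniform_dist (D : {set T}) : D != finset.set0 -> is_dist (uniform D).
Proof.
rewrite -card_gt0 => D0; split=> [x|].
  by rewrite /uniform divr_ge0 ?ler0n.
rewrite /uniform -mulr_suml -natr_sum -big_mkcond sum1_card divff //.
by rewrite pnatr_eq0 -lt0n.
Qed.

Lemma uniform_ge (D : {set T}) x : x \in D -> #|T|%:R^-1 <= uniform D x.
Proof.
move=> xD; rewrite /uniform xD mul1r lef_pV2 ?ler_nat ?max_card // posrE ltr0n.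
  by apply/card_gt0P; exists x.
by apply/card_gt0P; exists x.
Qed.

Lemma uniform_notin (D : {set T}) x : x \notin D -> uniform D x = 0.
Proof. by rewrite /uniform => /negbTE ->; rewrite mul0r. Qed.

Lemma positive_lower_bound (f : T -> R) :
  exists d, [/\ 0 < d, d <= 1 & forall x, 0 < f x -> d <= f x].
Proof.
(* The initial value 1 ensures [d <= 1] and covers the case in which [f] has no positive value. *)
exists (\big[Order.min/1]_(x | 0 < f x) f x); split.
- by elim/big_ind: _ => // x y x0 y0; rewrite lt_min x0.
- exact: bigmin_le_id.
- by move=> x fx; apply: bigmin_le_cond.
Qed.

Lemma sum_dist_le (p f : T -> R) c : is_dist p ->
  (forall x, 0 < p x -> f x <= c) -> \sum_x p x * f x <= c.
Proof.
move=> [p0 p1] fc; rewrite -[leRHS]mul1r -p1 mulr_suml; apply: ler_sum => x _.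
have := p0 x; rewrite le_eqVlt => /predU1P[<-|px]; first by rewrite !mul0r.
by rewrite ler_wpM2l ?fc.
Qed.

Lemma sum_dist_ge (p f : T -> R) c : is_dist p ->
  (forall x, 0 < p x -> c <= f x) -> c <= \sum_x p x * f x.
Proof.
move=> dp fc; rewrite -lerN2 -sumrN; under eq_bigr do rewrite -mulrN.
by apply: sum_dist_le => // x px; rewrite lerN2 fc.
Qed.

(** The single outcome [x] lowers the average by its probability times its deficit, since no other
    outcome exceeds 1. *)
Lemma sum_dist_drop (p f : T -> R) x c : is_dist p ->
  (forall y, 0 < p y -> f y <= 1) -> c <= p x * (1 - f x) ->
  \sum_y p y * f y <= 1 - c.
Proof.
move=> [p0 p1] f1 cx; rewrite -[1 in leRHS]p1 lerBrDr -lerBrDl -sumrB.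
apply: le_trans cx _; rewrite (bigD1 x) //= mulrBr mulr1 lerDl.
apply: sumr_ge0 => y _; rewrite -{1}[p y]mulr1 -mulrBr.
have := p0 y; rewrite le_eqVlt => /predU1P[<-|py]; first by rewrite mul0r.
by rewrite mulr_ge0 ?p0 // subr_ge0 f1.
Qed.

Lemma uniform_gt0 (D : {set T}) x : 0 < uniform D x -> x \in D.
Proof. by apply: contraTT => /uniform_notin ->; rewrite ltxx. Qed.

End Distributions.

Lemma uniform_avail (R : realType) (S A : finType) (avail D : S -> {set A}) s a :
  D s \subset avail s -> a \notin avail s -> uniform R (D s) a = 0.
Proof.
move=> /fintype.subsetP Ds as_; apply: uniform_notin.
by apply: contra as_; exact: Ds.
Qed.

Lemma Pr_eq1 d (T : measurableType d) (R : realType) (P : probability T R)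
    (N B : set T) :
  measurable N -> measurable B -> P N = 0%E -> ~` N `<=` B -> P B = 1%E.
Proof.
move=> mN mB N0 NB.
apply/eqP; rewrite eq_le; apply/andP; split; first exact: probability_le1.
have <- : P (~` N) = 1%E by rewrite probability_setC // N0 sube0.
by apply: le_measure; rewrite ?inE //; exact: measurableC.
Qed.

Lemma borel_cantelli_geometric d (T : measurableType d) (R : realType)
    (P : probability T R) (F : nat -> set T) (a z : R) :
  0 <= a -> 0 <= z < 1 -> (forall n, measurable (F n)) ->
  (forall n, P (F n) <= (a * z ^+ n)%:E)%E -> P (lim_sup_set F) = 0%E.
Proof.
move=> a0 /andP[z0 z1] mF PF; apply: lim_sup_set_cvg0 => //.
apply: le_lt_trans (ltry (a / (1 - z))).
apply: lime_le; first exact: is_cvg_nneseries.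
apply: nearW => n; apply: le_trans (lee_sum _ (fun i _ => PF i)) _.
rewrite sumEFin lee_fin ler_pdivlMr ?subr_gt0 // -mulr_sumr -mulrA.
rewrite -[leRHS]mulr1 ler_wpM2l // big_mkord mulrC.
have -> : (1 - z) * (\sum_(i < n) z ^+ i) = 1 - z ^+ n.
  by rewrite -[LHS]opprK -mulNr opprB -subrX1 opprB.
by rewrite gerBl exprn_ge0.
Qed.

(** * Ranks and the strategy of player 2 *)

Section Player2.
Variables (R : realType) (S A : finType) (G : game R S A).
Variable r : S -> A -> A -> bool.

Local Notation T := (round S A).
Local Notation Y := (Ystar G r).
Local Notation F := (fun Z => ASP G r [set: S]%SET Y Z).

Lemma Ystar_fix : nuZ G r Y = Y.
Proof. by apply: fixsetK => Z Z'; exact: nuZ_mono. Qed.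

(** The round in which the iteration of the greatest fixpoint removes [s], and 0 for the states of
    [Y], which are never removed. *)
Definition rank s := fix_order (funsetC F) s.

Let funsetC_mono : {homo funsetC F : X X' / X \subset X'}.
Proof.
move=> Z Z' ZZ'; rewrite finset.setCS; apply: ASP_mono => //.
by rewrite finset.setCS.
Qed.

Lemma rank_gt0 s : (0 < rank s)%N = (s \notin Y).
Proof. by rewrite -Ystar_fix inE negbK fix_order_gt0. Qed.

Lemma rank_le s : (rank s <= #|S|)%N.
Proof. exact: fix_order_le_max. Qed.

(** When [s] is removed, [a] is not Good with respect to the states still present. So some non-Bad
    reply gives reward 0 or may lead to a state removed earlier. *)
Lemma Player2_escape s a : s \notin Y -> a \in avail1 G s ->
  exists2 b, b \in avail2 G s :\: Bad2 G s [set: S]%SET Y &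
    (exists2 t, t \in Succ G s a b & (rank t < rank s)%N) \/ ~~ r s a b.
Proof.
move=> sY aG; have sr : (0 < rank s)%N by rewrite rank_gt0.
have : s \in iter (rank s) (funsetC F) finset.set0.
  by rewrite in_iter_fix_orderE // -fix_order_gt0.
rewrite -(prednK sr) iterS; set W := iter _ _ _ => sW.
have : s \notin F (~: W) by move: sW; rewrite !inE.
rewrite inE negbK => /eqP/finset.setP/(_ a); rewrite !inE -/(Allow1 _ _ _).
rewrite aG /=; have -> : [forall b in avail2 G s, Succ G s a b \subset [set: S]%SET].
  by apply/forall_inP => b _; exact: finset.subsetT.
move=> /negbT; rewrite negb_forall => /existsP[b].
rewrite negb_imply negb_and => /andP[bD h]; exists b => //.
case/orP: h => [/fintype.subsetPn[t tS]|]; last by right.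
rewrite inE negbK => tW; left; exists t => //.
by rewrite -ltnS prednK // ltnS (leq_ltn_trans (fix_order_small funsetC_mono tW)) // prednK.
Qed.

(** Inside [Y] all available actions are allowed, so that the set is nonempty at every state. *)
Definition safe2 s : {set A} :=
  if s \in Y then avail2 G s else avail2 G s :\: Bad2 G s [set: S]%SET Y.

Lemma safe2_sub s : safe2 s \subset avail2 G s.
Proof. by rewrite /safe2; case: ifP => _; [exact: fintype.subxx|exact: finset.subsetDl]. Qed.

Lemma safe2_neq0 s : safe2 s != finset.set0.
Proof.
rewrite /safe2; case: ifPn => [_|sY].
  by have [b bG] := avail2_ex G s; apply/set0Pn; exists b.
have [a aG] := avail1_ex G s; have [b bD _] := Player2_escape sY aG.
by apply/set0Pn; exists b.
Qed.

Lemma safe2_stay s a b t : s \notin Y -> a \in avail1 G s -> b \in safe2 s ->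
  t \in Succ G s a b -> t \notin Y.
Proof.
move=> sY aG; rewrite /safe2 (negbTE sY) inE => /andP[nb bG] tS.
by apply: contra nb => tY; apply/(Bad2P Y bG); exists a => //; exists t.
Qed.

Definition spoiler : strategy2 G :=
  @Strategy R S A (avail2 G) (fun _ s => uniform R (safe2 s))
    (fun _ s => uniform_dist R (safe2_neq0 s))
    (fun _ s b => uniform_avail R (safe2_sub s)).

(* [1 - eta ^+ rank s] is the weight of [s] in the supermartingale: from [s],
   with probability at least [p] the play loses a reward or decreases the rank,
   and [eta] is small enough compared with [p] for this to compensate the
   possible increase of the rank otherwise. *)
Lemma spoiler_drift : exists eta, [/\ 0 < eta, eta <= 4^-1 &
  forall s a, s \notin Y -> a \in avail1 G s ->
    \sum_b uniform R (safe2 s) b * ((if r s a b then 1 else 2^-1) *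
      \sum_t delta G s a b t * (1 - eta ^+ rank t))
    <= (1 - eta ^+ #|S|) * (1 - eta ^+ rank s)].
Proof.
have [d [d0 d1 dP]] := positive_lower_bound
  (fun x : S * A * A * S => delta G x.1.1.1 x.1.1.2 x.1.2 x.2).
(* [d] is a lower bound for the positive transition probabilities, and [q] one for the probability
   of each safe action of player 2. *)
pose q : R := (#|A|.+1)%:R^-1.
have q0 : 0 < q by rewrite invr_gt0 ltr0n.
have q1 : q <= 1 by rewrite invf_le1 ?ltr0n // ler1n.
(* This gives [2 * eta ^+ k <= q * d * eta ^+ k.-1] for positive [k], so a possible decrease of the
   rank outweighs all losses. *)
pose eta := q * d / 4.
have pq : 0 < q * d by rewrite mulr_gt0.
have pq1 : q * d <= 1 by rewrite mulr_ile1 // ltW.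
have eta0 : 0 < eta by rewrite /eta; lra.
have eta1 : eta <= 4^-1 by rewrite /eta; lra.
have eta01 : 0 <= eta <= 1 by apply/andP; split; lra.
have eta_ge k l : (k <= l)%N -> eta ^+ l <= eta ^+ k.
  by move=> kl; apply: ler_wiXn2l; case/andP: eta01.
have eX k : 0 <= eta ^+ k <= 1.
  by case/andP: eta01 => ? ?; rewrite exprn_ge0 ?exprn_ile1.
exists eta; split=> // s a sY aG.
pose f b := (if r s a b then 1 else 2^-1) *
  \sum_t delta G s a b t * (1 - eta ^+ rank t).
rewrite -[leLHS]/(\sum_b uniform R (safe2 s) b * f b).
have dl s' a' b' t : 0 < delta G s' a' b' t -> d <= delta G s' a' b' t.
  by move=> /(dP (s', a', b', t)).
have S0 b : b \in avail2 G s ->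
    0 <= \sum_t delta G s a b t * (1 - eta ^+ rank t) <= 1.
  move=> bG; have dd := delta_dist aG bG; apply/andP; split.
    by apply: sum_dist_ge => // t _; case/andP: (eX (rank t)) => _ ?; lra.
  by apply: sum_dist_le => // t _; case/andP: (eX (rank t)) => ? _; lra.
have f1 b : 0 < uniform R (safe2 s) b -> f b <= 1.
  move=> /uniform_gt0 /(fintype.subsetP (safe2_sub s)) /S0 /andP[h0 h1].
  by rewrite /f; case: (r s a b); lra.
have k0 : (0 < rank s)%N by rewrite rank_gt0.
have ek : eta ^+ rank s <= eta by rewrite -[leRHS]expr1; exact: eta_ge.
(* As [eta ^+ #|S| <= eta ^+ rank s], it is enough to stay below [1 - 2 * eta ^+ rank s]. *)
have : 1 - 2 * eta ^+ rank s <= (1 - eta ^+ #|S|) * (1 - eta ^+ rank s).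
  have := eta_ge _ _ (rank_le s); have /andP[? _] := eX #|S|.
  by have /andP[? _] := eX (rank s); nra.
apply: le_trans; have [b bD bP] := Player2_escape sY aG.
have bs : b \in safe2 s by rewrite /safe2 (negbTE sY).
have bG := fintype.subsetP (safe2_sub s) _ bs.
apply: (sum_dist_drop (x := b)) => //; first exact: uniform_dist (safe2_neq0 s).
have ub : q <= uniform R (safe2 s) b.
  apply: le_trans (uniform_ge R bs); rewrite /q lef_pV2 ?ler_nat // posrE ltr0n //.
  by apply/card_gt0P; exists b.
have qf : 2 * eta ^+ rank s <= q * (1 - f b).
  case: bP => [[t tS tr]|nr]; last first.
    rewrite /f (negbTE nr); have /andP[? ?] := S0 b bG.
    rewrite /eta in ek *; nra.
  have h : d * eta ^+ (rank s).-1 <= 1 - f b.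
    have : \sum_t delta G s a b t * (1 - eta ^+ rank t) <= 1 - d * eta ^+ (rank s).-1.
      apply: (sum_dist_drop (x := t)); first exact: delta_dist.
        by move=> t' _; case/andP: (eX (rank t')) => ? _; lra.
      rewrite opprB addrC subrK; apply: ler_pM => //; first exact: ltW.
      - by case/andP: (eX (rank s).-1).
      - by apply: dl; move: tS; rewrite inE.
      - by apply: eta_ge; rewrite -ltnS prednK.
    by rewrite /f; case: (r s a b); have /andP[? ?] := S0 b bG; lra.
  apply: le_trans (ler_wpM2l (ltW q0) h).
  rewrite -[in leLHS](prednK k0) exprS /eta mulrA.
  have /andP[e0 _] := eX (rank s).-1; rewrite /eta in e0; nra.
apply: le_trans qf _; apply: ler_wpM2r (ub).
by rewrite subr_ge0; apply: f1; exact: lt_le_trans q0 ub.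
Qed.

End Player2.
Section StateDistribution.
Variables (R : realType) (S A : finType) (G : game R S A).
Variables (s0 : S) (sigma1 : strategy1 G) (sigma2 : strategy2 G).

Local Notation T := (round S A).
Local Notation cp := (cylinder_prob s0 sigma1 sigma2).

Lemma state_prob_rcons h s a b : state_prob G s0 (rcons h (s, a, b)) = delta G s a b.
Proof. by apply/funext => t; rewrite /state_prob rev_rcons. Qed.

Lemma state_prob_nil s : state_prob G s0 [::] s = (s == s0)%:R.
Proof. by []. Qed.

Lemma state_prob_dist h : cp h != 0 -> is_dist (state_prob G s0 h).
Proof.
case/lastP: h => [_|h [[s a] b]].
  split=> [s|]; first exact: ler0n.
  by rewrite (bigD1 s0) //= state_prob_nil eqxx big1 ?addr0 // => s /negbTE ss0;
    rewrite state_prob_nil ss0.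
move=> /cp_avail[_ _ a0 b0]; rewrite state_prob_rcons.
by apply: delta_dist; [exact: strategy_avail1 a0|exact: strategy_avail2 b0].
Qed.

Lemma sum_round (f : T -> R) : \sum_x f x = \sum_s \sum_a \sum_b f (s, a, b).
Proof. by rewrite !pair_bigA; apply: eq_bigr => -[[]]. Qed.

Lemma cp_rcons h s a b : cp (rcons h (s, a, b)) =
  cp h * (state_prob G s0 h s * (sigma1 h s a * sigma2 h s b)).
Proof. by rewrite cylinder_prob_rcons /round_prob !mulrA. Qed.

End StateDistribution.

(** * The supermartingale and almost sure success of player 2 *)

Section Spoiler.
Variables (R : realType) (S A : finType) (G : game R S A).
Variable r : S -> A -> A -> bool.
Variables (s0 : S) (sigma1 : strategy1 G).

Local Notation T := (round S A).
Local Notation Y := (Ystar G r).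
Local Notation sigma2 := (spoiler G r).
Local Notation cp := (cylinder_prob s0 sigma1 sigma2).
Local Notation Pr := (play_prob s0 sigma1 sigma2).

Hypothesis s0Y : s0 \notin Y.

Lemma spoiler_avoids h s : cp h != 0 -> 0 < state_prob G s0 h s -> s \notin Y.
Proof.
elim/last_ind: h s => [|h [[s' a] b] IH] s.
  by move=> _; rewrite state_prob_nil; case: (eqVneq s s0) => [->//|]; rewrite ltxx.
move=> /cp_avail[h0 st0 a0 b0]; rewrite state_prob_rcons => d0.
apply: (@safe2_stay R S A G r s' a b) => //.
- exact: IH.
- exact: strategy_avail1 a0.
- exact: uniform_gt0 b0.
- by rewrite inE.
Qed.

Variable eta : R.
Hypothesis eta_gt0 : 0 < eta.
Hypothesis eta_le : eta <= 4^-1.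
Hypothesis drift : forall s a, s \notin Y -> a \in avail1 G s ->
  \sum_b uniform R (safe2 G r s) b * ((if r s a b then 1 else 2^-1) *
    \sum_t delta G s a b t * (1 - eta ^+ rank G r t))
  <= (1 - eta ^+ #|S|) * (1 - eta ^+ rank G r s).

Local Notation rho := (1 - eta ^+ #|S|).
Local Notation g := (fun s => 1 - eta ^+ rank G r s).

Let eX k : 0 <= eta ^+ k <= 1.
Proof.
have e0 := ltW eta_gt0; rewrite exprn_ge0 // exprn_ile1 //.
by apply: le_trans eta_le _; lra.
Qed.

(** The integral, over the cylinder of [h], of 2^-(number of zeros in [h]) times the weight of the
    current state. *)
Definition spoiler_potential h := cp h * 2^-1 ^+ zeros r h * \sum_s state_prob G s0 h s * g s.

Lemma spoiler_potential_drift h : \sum_x spoiler_potential (rcons h x) <= rho * spoiler_potential h.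
Proof.
rewrite sum_round /spoiler_potential.
have [h0|h0] := eqVneq (cp h) 0.
  rewrite h0 !mul0r mulr0 big1 // => s _; rewrite big1 // => a _.
  by rewrite big1 // => b _; rewrite cp_rcons h0 !mul0r.
have [st0 st1] := state_prob_dist h0.
pose f s a b : R := (if r s a b then 1 else 2^-1) * \sum_t delta G s a b t * g t.
have -> : \sum_s \sum_a \sum_b spoiler_potential (rcons h (s, a, b)) =
    cp h * 2^-1 ^+ zeros r h * \sum_s state_prob G s0 h s *
      \sum_a sigma1 h s a * \sum_b sigma2 h s b * f s a b.
  rewrite mulr_sumr; apply: eq_bigr => s _; rewrite !mulr_sumr.
  apply: eq_bigr => a _; rewrite !mulr_sumr; apply: eq_bigr => b _.
  rewrite /spoiler_potential cp_rcons zeros_rcons state_prob_rcons /f exprD /=.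
  by case: (r s a b); rewrite /= ?expr0 ?expr1; ring.
rewrite [leRHS]mulrCA ler_wpM2l //.
  by rewrite mulr_ge0 ?cp_ge0 // exprn_ge0 // invr_ge0 ler0n.
rewrite mulr_sumr; apply: ler_sum => s _.
rewrite mulrCA; have := st0 s; rewrite le_eqVlt => /predU1P[<-|st].
  by rewrite !mul0r.
rewrite ler_pM2l //; apply: sum_dist_le; first exact: choice_dist.
move=> a a0; apply: drift; first exact: spoiler_avoids st.
exact: strategy_avail1 a0.
Qed.

Lemma spoiler_potential_nil : spoiler_potential [::] <= 1.
Proof.
have c1 : cp [::] = 1 by rewrite /cylinder_prob big_ord0.
have c_neq0 : cp [::] != 0 by rewrite c1 oner_neq0.
rewrite /spoiler_potential c1 expr0 !mul1r; apply: sum_dist_le => [|s _].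
  exact: state_prob_dist c_neq0.
by case/andP: (eX (rank G r s)) => ? _; lra.
Qed.

(** Outside [Y] ranks are positive, so each state reached has weight at least [1 - eta], which is
    above 1/2. *)
Lemma spoiler_potential_ge h : cp h * 2^-1 ^+ zeros r h <= 2 * spoiler_potential h.
Proof.
have [h0|h0] := eqVneq (cp h) 0; first by rewrite /spoiler_potential h0 !mul0r mulr0.
have c0 : 0 <= cp h * 2^-1 ^+ zeros r h.
  by rewrite mulr_ge0 ?cp_ge0 // exprn_ge0 // invr_ge0 ler0n.
rewrite /spoiler_potential mulrCA -[leLHS]mulr1 ler_wpM2l //.
suff : 2^-1 <= \sum_s state_prob G s0 h s * g s by lra.
apply: sum_dist_ge; first exact: state_prob_dist h0.
move=> s st; have : s \notin Y by exact: spoiler_avoids st.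
rewrite -rank_gt0; case: (rank G r s) => // k _.
have /andP[_ ek] := eX k; have : eta ^+ k.+1 <= eta.
  by rewrite exprS ler_piMr // ltW.
by have := eta_le; lra.
Qed.

Local Notation z := (1 - eta ^+ #|S| / 2).

Let z01 : 0 < z < 1.
Proof. by have := exprn_gt0 #|S| eta_gt0; case/andP: (eX #|S|) => ? ? ?; apply/andP; split; lra. Qed.

(** Markov's inequality: on the event, 2^-zeros is at least z^(K zeros) and hence at least z^n,
    whereas its expectation is at most 2 rho^n, which is below 2 z^(2n). *)
Lemma spoiler_tail (K n : nat) : z ^+ K <= 2^-1 ->
  (Pr [set w | (K * zeros r (mkseq w n) <= n)%N] <= (2 * z ^+ n)%:E)%E.
Proof.
move=> zK; have /andP[z0 z1] := z01.
have -> : Pr [set w | (K * zeros r (mkseq w n) <= n)%N] =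
    (ext_sum n (fun g => (K * zeros r g <= n)%N%:R * cp g) [::])%:E.
  exact: (Pr_prefix0 _ _ _ n (fun g => (K * zeros r g <= n)%N)).
rewrite lee_fin -(ler_pM2l (exprn_gt0 n z0)) -ext_sumZ.
apply: (le_trans (y := ext_sum n (fun g => 2 * spoiler_potential g) [::])).
  apply: ext_sum_le => h; apply: le_trans (spoiler_potential_ge h).
  case: leqP => Kz; last by rewrite mul0r mulr0 mulr_ge0 ?cp_ge0 ?exprn_ge0 ?invr_ge0.
  rewrite mul1r mulrC ler_wpM2l ?cp_ge0 //.
  apply: le_trans (ler_wiXn2l (ltW z0) (ltW z1) Kz) _.
  by rewrite exprM lerXn2r // nnegrE ?exprn_ge0 ?invr_ge0 // ltW.
have rho0 : 0 <= rho by case/andP: (eX #|S|) => ? ?; lra.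
rewrite ext_sumZ; have := ext_sum_geometric n [::] rho0 spoiler_potential_drift.
have := spoiler_potential_nil; have := exprn_ge0 n rho0.
have : rho ^+ n <= z ^+ n * z ^+ n.
  rewrite -exprMn lerXn2r ?nnegrE //; first by rewrite mulr_ge0 // ltW.
  by case/andP: (eX #|S|) => ? ?; nra.
nra.
Qed.

Lemma spoiler_wins (K : nat) : (0 < K)%N -> z ^+ K <= 2^-1 ->
  Pr (less_than G (LimSupAvg R r) (1 - K%:R^-1 / 2)) = 1%E.
Proof.
move=> K0 zK; have /andP[z0 z1] := z01.
pose B n : set (infseq_meas (round0 G s0)) :=
  [set w | (K * zeros r (mkseq w n) <= n)%N].
have mB n : measurable (B n).
  exact: (measurable_prefix n (fun g => (K * zeros r g <= n)%N)).
have B0 : Pr (lim_sup_set B) = 0%E.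
  apply: (@borel_cantelli_geometric _ _ _ _ _ 2 z) => //; first by rewrite ltW.
  by move=> n; exact: spoiler_tail.
have mlB : measurable (lim_sup_set B).
  apply: bigcapT_measurable => n; apply: bigcup_measurable => k _; exact: mB.
have mN := measurable_null_plays sigma1 sigma2 (s0 := s0).
apply: (@Pr_eq1 _ (infseq_meas (round0 G s0)) R Pr
  (null_plays (s0 := s0) sigma1 sigma2 `|` lim_sup_set B)).
- exact: measurableU.
- by apply: measurable_less_than; exact: measurable_at_least_sup.
- by rewrite (measureU0 mN mlB B0); exact: null_playsE.
move=> w; rewrite setCU => -[/not_null_is_play wp wB]; split=> //.
rewrite ltNge; apply/negP => /(limn_sup_geP (avg_reward01 R r w)) H; apply: wB.
(* Index [2 * K] makes the tolerance smaller than half of 1/K, so the average exceeds 1 - 1/K;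
   [n.+1] excludes the average of index 0. *)
move=> n _; have [m nm le1] := H (2 * K)%N n.+1; exists m; first exact: ltnW.
case: m nm le1 => // m _; rewrite avg_rewardE /B /mkset => le1.
rewrite leqNgt; apply/negP => ltz.
set Z := zeros r _ in le1 ltz.
have K0' : 0 < K%:R :> R by rewrite ltr0n.
have m0 : 0 < m.+1%:R :> R by rewrite ltr0n.
have b2 : (2 * K).+1%:R^-1 < K%:R^-1 / 2 :> R.
  rewrite -invfM -natrM ltf_pV2 ?posrE ?ltr0n ?ltr_nat ?muln_gt0 ?K0 //.
  by rewrite mulnC ltnS leqnn.
have : Z%:R / m.+1%:R < K%:R^-1 :> R.
  move: le1 b2; rewrite mulrBl divff ?gt_eqF //.
  move: (Z%:R / _) (K%:R^-1) ((2 * K).+1%:R^-1) => x y v; lra.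
rewrite ltr_pdivrMr // -(ltr_pM2l K0') mulrA divff ?gt_eqF // mul1r.
by rewrite -natrM ltr_nat ltnNge ltnW.
Qed.

End Spoiler.

Lemma expr_small (R : realType) (z : R) : 0 < z < 1 ->
  exists2 K : nat, (0 < K)%N & z ^+ K <= 2^-1.
Proof.
move=> /andP[z0 z1]; have nz1 : `|z| < 1 by rewrite gtr0_norm.
have h0 : 0 < 2^-1 :> R by lra.
have /cvgrPdist_lt/(_ _ h0)[K _ KP] := cvg_expr nz1.
have := KP K (leqnn K); rewrite /= sub0r normrN gtr0_norm ?exprn_gt0 // => /ltW zK.
by exists K => //; case: K zK {KP} => //; rewrite expr0; lra.
Qed.

Lemma Almost2_outside_Ystar (R : realType) (S A : finType) (G : game R S A)
    (r : S -> A -> A -> bool) s : s \notin Ystar G r ->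
  exists2 c : R, 0 < c & Almost2 G (less_than G (LimSupAvg R r) (1 - c)) s.
Proof.
move=> sY; have [eta [e0 e4 drift]] := spoiler_drift G r.
have [|K K0 zK] := @expr_small R (1 - eta ^+ #|S| / 2).
  have := exprn_gt0 #|S| e0; have : eta ^+ #|S| <= 1 by apply: exprn_ile1; lra.
  by move=> ? ?; apply/andP; split; lra.
exists (K%:R^-1 / 2); first by rewrite divr_gt0 // invr_gt0 ltr0n.
by exists (spoiler G r) => sigma1; exact: (@spoiler_wins R S A G r s sigma1 sY eta e0 e4 drift K K0 zK).
Qed.

(** * Player 1 wins with positive probability inside the fixpoint *)

Section Player1.
Variables (R : realType) (S A : finType) (G : game R S A).
Variable r : S -> A -> A -> bool.

Local Notation T := (round S A).

Definition Yiter k : {set S} := iter k (nuZ G r) finset.set0.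

Definition layer s := fix_order (nuZ G r) s.

Lemma layer_gt0 s : (0 < layer s)%N = (s \in Ystar G r).
Proof. exact: fix_order_gt0. Qed.

Lemma mem_Yiter s k : (s \in Yiter k) = (0 < layer s <= k)%N.
Proof. exact: (in_iter_fixE (@nuZ_mono _ _ _ G r)). Qed.

(** The default value makes this an available action at every state, also outside [Y]. *)
Definition good_action s : A :=
  odflt (xchoose (avail1_ex G s))
    [pick a in Good1 G r s [set: S]%SET (Yiter (layer s).-1) (Yiter (layer s))].

Lemma good_action_avail s : good_action s \in avail1 G s.
Proof.
rewrite /good_action; case: pickP => [a|_] /=; last exact: xchooseP.
by rewrite inE Allow1_setT => /andP[].
Qed.

(** [Yiter (layer s)] is [nuZ] of the previous iterate, hence a fixpoint of [ASP]; as it contains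
    [s], a Good action exists there. *)
Lemma good_actionP s b : (0 < layer s)%N -> b \in avail2 G s ->
  b \notin Bad2 G s [set: S]%SET (Yiter (layer s).-1) ->
  r s (good_action s) b /\
  forall t, t \in Succ G s (good_action s) b -> (0 < layer t <= layer s)%N.
Proof.
move=> s0 bG nb; rewrite /good_action; case: pickP => [a|none] /=; last first.
  have YS : Yiter (layer s) = nuZ G r (Yiter (layer s).-1).
    by rewrite -{1}(prednK s0).
  have : s \in Yiter (layer s) by rewrite mem_Yiter s0 leqnn.
  rewrite YS -nuZ_fix -YS.
  by rewrite inE => /set0Pn[a]; rewrite none.
rewrite inE => /andP[_ /forall_inP/(_ b)]; rewrite inE bG nb => /(_ isT).
move=> /andP[/fintype.subsetP sub rb]; split=> // t /sub.
by rewrite mem_Yiter.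
Qed.

Definition explore (k : nat) : R := (k.+2%:R ^+ 2)^-1.

Lemma explore01 k : 0 < explore k < 1.
Proof.
rewrite /explore invr_gt0 exprn_gt0 ?ltr0n //= invf_lt1 ?exprn_gt0 ?ltr0n //.
by rewrite exprn_egt1 // ltr1n.
Qed.

(** The uniform part keeps every available action possible at all times, so that a Bad action of
    player 2 always risks a move to a lower layer. *)
Definition optimist_prob (h : seq T) s a : R :=
  (1 - explore (size h)) * (a == good_action s)%:R +
  explore (size h) * uniform R (avail1 G s) a.

Lemma avail1_neq0 s : avail1 G s != finset.set0.
Proof. by have [a aG] := avail1_ex G s; apply/set0Pn; exists a. Qed.

Lemma optimist_dist h s : is_dist (optimist_prob h s).
Proof.
have /andP[e0 e1] := explore01 (size h).
have [u0 u1] := uniform_dist R (avail1_neq0 s); split=> [a|].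
  by rewrite addr_ge0 // mulr_ge0 ?u0 ?ler0n ?subr_ge0 ?ltW.
rewrite big_split /= -!mulr_sumr u1 mulr1 (bigD1 (good_action s)) //= eqxx.
by rewrite big1 ?addr0 ?mulr1 ?subrK // => a /negbTE ->.
Qed.

Lemma optimist_avail h s a : a \notin avail1 G s -> optimist_prob h s a = 0.
Proof.
move=> aG; rewrite /optimist_prob uniform_notin // mulr0 addr0.
by case: eqVneq aG => [->|]; rewrite ?good_action_avail // mulr0.
Qed.

Definition optimist : strategy1 G :=
  @Strategy R S A (avail1 G) optimist_prob optimist_dist optimist_avail.

Lemma optimist_gt0 h s a : a \in avail1 G s -> 0 < optimist h s a.
Proof.
move=> aG; have /andP[e0 e1] := explore01 (size h).
rewrite /= /optimist_prob ltr_wpDl ?mulr_ge0 ?ler0n ?subr_ge0 ?ltW //.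
rewrite mulr_gt0 //; apply: lt_le_trans (uniform_ge R aG).
by rewrite invr_gt0 ltr0n; apply/card_gt0P; exists a.
Qed.

Lemma optimist_good h s : 1 - explore (size h) <= optimist h s (good_action s).
Proof.
have /andP[e0 e1] := explore01 (size h).
have [u0 _] := uniform_dist R (avail1_neq0 s).
by rewrite /= /optimist_prob eqxx mulr1 lerDl mulr_ge0 // ltW.
Qed.

(* [1 - explore k = slack k.+1 / slack k], so that products of consecutive such
   factors telescope and remain above 1/2. *)
Definition slack (k : nat) : R := k.+2%:R / k.+1%:R.

Lemma slackS k : slack k.+1 = slack k * (1 - explore k).
Proof.
rewrite /slack /explore; have : k.+1%:R != 0 :> R by rewrite pnatr_eq0.
have : k.+2%:R != 0 :> R by rewrite pnatr_eq0.
rewrite -!natr1 => h1 h2; field; exact/andP.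
Qed.

Lemma slack_bounds k : 1 <= slack k <= 2.
Proof.
rewrite /slack ler_pdivlMr ?ltr0n // ler_pdivrMr ?ltr0n // mul1r ler_nat leqnSn /=.
by rewrite -natrM ler_nat mul2n -addnn addSn !addnS !ltnS leq_addr.
Qed.

(** * Ideal continuations against a fixed strategy of player 2 *)

Section Play.
Variables (s0 : S) (sigma2 : strategy2 G).

Local Notation cp := (cylinder_prob s0 optimist sigma2).
Local Notation st := (state_prob G s0).
Local Notation Pr := (play_prob s0 optimist sigma2).

Definition ideal (k : nat) (x : T) := let: (s, a, b) := x in
  [&& layer s == k, a == good_action s & r s a b].

Lemma cp_rcons_gt0 h s a b : cp h != 0 -> 0 < st h s -> a \in avail1 G s ->
  0 < sigma2 h s b -> cp (rcons h (s, a, b)) != 0.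
Proof.
move=> h0 st0 aG b0; rewrite cp_rcons mulf_neq0 // gt_eqF //.
by rewrite !mulr_gt0 // optimist_gt0.
Qed.

Lemma ext_sum_le_cat n (f g : seq T -> R) h :
  (forall e, size e = n -> f (h ++ e) <= g (h ++ e)) ->
  ext_sum n f h <= ext_sum n g h.
Proof.
elim: n h => [|n IH] h fg; first by have := fg [::] erefl; rewrite cats0.
apply: ler_sum => x _; apply: IH => e en; rewrite cat_rcons; apply: fg.
by rewrite /= en.
Qed.

(** By hypothesis, after ideal rounds the Good action alone makes the next round ideal. Round [j] is
    thus ideal with conditional probability at least [1 - explore j], and the product of these
    factors stays above 1/2. *)
Lemma ideal_mass k h : cp h != 0 ->
  (forall e, all (ideal k) e -> cp (h ++ e) != 0 -> forall s, 0 < st (h ++ e) s ->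
    layer s = k /\ forall b, 0 < sigma2 (h ++ e) s b -> r s (good_action s) b) ->
  forall n, cp h / 2 <=
    ext_sum n (fun g => (all (ideal k) (drop (size h) g))%:R * cp g) h.
Proof.
move=> h0 H n.
pose V m := ext_sum m (fun g => (all (ideal k) (drop (size h) g))%:R * cp g) h.
rewrite -[leRHS]/(V n).
have VS m : (1 - explore (size h + m)) * V m <= V m.+1.
  rewrite /V -ext_sumZ ext_sumS; apply: ext_sum_le_cat => e em.
  rewrite drop_size_cat //; under eq_bigr do rewrite rcons_cat drop_size_cat //.
  have cge x : 0 <= (all (ideal k) (rcons e x))%:R * cp (h ++ rcons e x).
    by rewrite mulr_ge0 ?ler0n ?cp_ge0.
  have [ie|nie] := boolP (all (ideal k) e); last first.
    by rewrite mul0r mulr0; apply: sumr_ge0.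
  have [c0|c0] := eqVneq (cp (h ++ e)) 0.
    by rewrite c0 !mulr0; apply: sumr_ge0.
  rewrite mul1r; under eq_bigr => x _ do rewrite all_rcons ie andbT -rcons_cat.
  rewrite sum_round.
  have -> : \sum_s \sum_a \sum_b (ideal k (s, a, b))%:R *
      cp (rcons (h ++ e) (s, a, b)) = cp (h ++ e) * \sum_s st (h ++ e) s *
      \sum_a optimist (h ++ e) s a * \sum_b sigma2 (h ++ e) s b *
        (ideal k (s, a, b))%:R.
    rewrite mulr_sumr; apply: eq_bigr => s _; rewrite !mulr_sumr.
    apply: eq_bigr => a _; rewrite !mulr_sumr; apply: eq_bigr => b _.
    by rewrite cp_rcons; ring.
  rewrite mulrC ler_wpM2l ?cp_ge0 //.
  apply: sum_dist_ge; first exact: state_prob_dist c0.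
  move=> s s_gt0; have [sk rs] := H e ie c0 s s_gt0.
  rewrite (bigD1 (good_action s)) //=; apply: ler_wpDr.
    apply: sumr_ge0 => a _; apply: mulr_ge0.
      by case: (choice_dist optimist (h ++ e) s).
    apply: sumr_ge0 => b _; rewrite mulr_ge0 ?ler0n //.
    by case: (choice_dist sigma2 (h ++ e) s).
  apply: le_trans (_ : _ <= optimist (h ++ e) s (good_action s)) _.
    by rewrite -em -size_cat; exact: optimist_good.
  rewrite -[leLHS]mulr1 ler_wpM2l //.
    by case: (choice_dist optimist (h ++ e) s).
  apply: sum_dist_ge; first exact: choice_dist.
  by move=> b /rs rb; rewrite sk !eqxx rb.
have V0 : V 0%N = cp h by rewrite /V /= drop_size mul1r.
(* The product telescopes into a quotient of two values of [slack], both between 1 and 2. *)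
have Vn m : cp h * slack (size h + m) <= V m * slack (size h).
  elim: m => [|m IH]; first by rewrite addn0 V0.
  rewrite addnS slackS mulrA.
  have /andP[_ e1] := explore01 (size h + m).
  have /andP[s1 _] := slack_bounds (size h).
  apply: le_trans (_ : V m * slack (size h) * (1 - explore (size h + m)) <= _).
    by rewrite ler_wpM2r // subr_ge0 ltW.
  by rewrite mulrAC ler_wpM2r ?(le_trans ler01) // mulrC.
have /andP[s1 s2] := slack_bounds (size h).
have /andP[t1 _] := slack_bounds (size h + n).
have c0 : 0 <= cp h by exact: cp_ge0.
move: c0 (Vn n) s1 s2 t1; clear.
move: (V n) (cp h) (slack (size h)) (slack (size h + n)) => v c x y.
move=> c0 cv x1 x2 y1; have c1 : c <= v * x by apply: le_trans cv; rewrite ler_peMr.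
have v0 : 0 <= v.
  by have := le_trans c0 c1; rewrite pmulr_lge0 // (lt_le_trans ltr01).
by rewrite ler_pdivrMr // (le_trans c1) // ler_wpM2l.
Qed.

Lemma ideal_liminf k n0 (w : nat -> T) :
  (forall n, all (ideal k) (drop n0 (mkseq w (n0 + n)))) -> 1 <= LimInfAvg R r w.
Proof.
move=> Iw; have z_le n : (zeros r (mkseq w n) <= n0)%N.
  have [nn0|/ltnW nn0] := leqP n n0.
    by apply: leq_trans nn0; exact: zeros_le.
  rewrite -(cat_take_drop n0 (mkseq w n)) /zeros count_cat.
  have -> : count (fun x => ~~ r x.1.1 x.1.2 x.2) (drop n0 (mkseq w n)) = 0%N.
    apply/eqP; rewrite -leqn0 leqNgt -has_count -all_predC.
    have := Iw (n - n0)%N; rewrite subnKC //; apply: sub_all.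
    by move=> [[s a] b] /= /and3P[_ _ ->].
  by rewrite addn0 (leq_trans (count_size _ _)) // size_take_min geq_minl.
apply/(limn_inf_geP (avg_reward01 R r w)) => j.
(* At most [n0] rewards are 0, and [n0 / m] is below the tolerance from here on. *)
exists (n0 * j.+1).+1 => m nm; rewrite avg_rewardE.
have m0 : 0 < m%:R :> R by rewrite ltr0n; case: m nm.
rewrite mulrBl divff ?gt_eqF // lerD2l lerN2 ler_pdivrMr // mulrC.
rewrite ler_pdivlMr ?ltr0n // -natrM ler_nat.
by apply: leq_trans (ltnW nm); rewrite leq_mul2r z_le orbT.
Qed.

Lemma ideal_plays_win k h : cp h != 0 ->
  (forall e, all (ideal k) e -> cp (h ++ e) != 0 -> forall s, 0 < st (h ++ e) s ->
    layer s = k /\ forall b, 0 < sigma2 (h ++ e) s b -> r s (good_action s) b) ->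
  (0 < Pr (at_least G (LimInfAvg R r) 1))%E.
Proof.
move=> h0 H; pose play := infseq_meas (round0 G s0).
pose E n : set play := cylinder (round0 G s0) h `&`
  [set w | all (ideal k) (drop (size h) (mkseq w (size h + n)))].
have mE n : measurable (E n).
  apply: measurableI; first exact: measurable_cylinder.
  exact: (measurable_prefix (size h + n) (fun g => all (ideal k) (drop (size h) g))).
have PE n : ((cp h / 2)%:E <= Pr (E n))%E.
  have e := @Pr_prefix R S A G s0 optimist sigma2 n
    (fun g => all (ideal k) (drop (size h) g)) h.
  by rewrite [X in (_ <= X)%E]e lee_fin; exact: ideal_mass.
have mEE : measurable (\bigcap_n E n) by exact: bigcapT_measurable.
have EE : ((cp h / 2)%:E <= Pr (\bigcap_n E n))%E.
  (* Continuity from above carries the uniform lower bound over to the intersection of the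
     decreasing events. *)
  have cvE : (Pr \o E) n @[n --> \oo] --> Pr (\bigcap_n E n).
    apply: nonincreasing_cvg_mu => //.
      by apply: le_lt_trans (probability_le1 _ _) _; rewrite ?ltry.
    apply/nonincreasing_seqP => n; apply/subsetPset => w [wh wn]; split=> //.
    move: wn; rewrite /mkset addnS mkseqS drop_rcons ?size_mkseq ?leq_addr //.
    by rewrite all_rcons => /andP[].
  rewrite -(cvg_lim _ cvE) //; apply: lime_ge; first by apply/cvg_ex; eexists; exact: cvE.
  by apply: nearW => n; exact: PE.
have mL := @measurable_at_least_inf R S A G r s0 1.
have mN := measurable_null_plays optimist sigma2 (s0 := s0).
(* Sequences in the limit event may violate the rules of the game; such ones are absorbed by
   adjoining the null set. *)
rewrite -(measureU0 mL mN (@null_playsE R S A G s0 optimist sigma2)).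
apply: (@lt_le_trans _ _ (cp h / 2)%:E).
  by rewrite lte_fin divr_gt0 // lt_def h0 cp_ge0.
apply: le_trans EE _; apply: le_measure; rewrite ?inE //; first exact: measurableU.
move=> w Ew; have [wN|wN] := pselect (null_plays optimist sigma2 w); [by right|left].
split; first exact: not_null_is_play wN.
by apply: (@ideal_liminf k (size h)) => n; have [] := Ew n I.
Qed.

(** Strong induction on the layer, by contradiction: if player 1 did not win, no lower layer could
    be reached with positive probability. Player 2 would then never play a Bad action in layer [k],
    and the ideal continuations would win after all. *)
Lemma optimist_wins h s : cp h != 0 -> 0 < st h s -> s \in Ystar G r ->
  (0 < Pr (at_least G (LimInfAvg R r) 1))%E.
Proof.
move=> h0 st0 sY; apply: contrapT => nowin.
have [k ek] : exists k, layer s = k by eexists.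
elim/ltn_ind: k => k IH in h s h0 st0 sY ek *.
have lower g t : cp g != 0 -> 0 < st g t -> (0 < layer t <= k)%N -> layer t = k.
  move=> g0 gt /andP[t0]; rewrite leq_eqVlt => /predU1P[//|tk].
  by case: (IH _ tk g t g0 gt _ erefl); rewrite -layer_gt0.
have k0 : (0 < k)%N by rewrite -ek layer_gt0.
have nonbad g t b : cp g != 0 -> 0 < st g t -> layer t = k -> 0 < sigma2 g t b ->
    b \notin Bad2 G t [set: S]%SET (Yiter k.-1).
  move=> g0 gt tk b0; have bG := strategy_avail2 b0.
  apply/negP => /(Bad2P _ bG)[a aG [t' t'S]].
  rewrite mem_Yiter => /andP[t'0 t'k].
  have g0' := cp_rcons_gt0 g0 gt aG b0.
  have : layer t' = k.
    apply: (lower _ t' g0'); first by rewrite state_prob_rcons; rewrite inE in t'S.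
    by rewrite t'0 (leq_trans t'k) ?leq_pred.
  by move=> t'E; move: t'k; rewrite t'E leqNgt ltn_predL k0.
(* Without Bad actions the Good action earns reward 1 and leads to layers 1 to [k], of which only
   [k] itself is reachable. *)
have stay g t b : cp g != 0 -> 0 < st g t -> layer t = k -> 0 < sigma2 g t b ->
    r t (good_action t) b /\
    forall t', 0 < st (rcons g (t, good_action t, b)) t' -> layer t' = k.
  move=> g0 gt tk b0; have bG := strategy_avail2 b0.
  have t0 : (0 < layer t)%N by rewrite tk.
  have nb : b \notin Bad2 G t [set: S]%SET (Yiter (layer t).-1).
    by rewrite tk; exact: nonbad g0 gt tk b0.
  have [rb sb] := good_actionP t0 bG nb; split=> // t' t'0.
  have g0' := cp_rcons_gt0 g0 gt (good_action_avail t) b0.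
  apply: lower g0' (t'0) _; rewrite -tk; apply: sb.
  by move: t'0; rewrite state_prob_rcons inE.
(* The history [h] may also allow states other than [s]. After one more round, with the Good action
   at [s], all possible states lie in layer [k], as [ideal_plays_win] requires. *)
have [b b0] := dist_ex (choice_dist sigma2 h s).
have h10 := cp_rcons_gt0 h0 st0 (good_action_avail s) b0.
have [_ h1k] := stay _ _ _ h0 st0 ek b0.
apply: nowin; apply: (@ideal_plays_win k _ h10) => e ie c0 t t0.
have tk : layer t = k.
  elim/last_ind: e ie c0 t t0 => [|e [[s' a] b'] _]; first by rewrite cats0 => _ _; exact: h1k.
  rewrite all_rcons -rcons_cat => /andP[/and3P[/eqP s'k /eqP -> _] _].
  by move=> /cp_avail[c0 s'0 _ b'0] t; have [_] := stay _ _ _ c0 s'0 s'k b'0; exact.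
by split=> // b' b'0; have [] := stay _ _ _ c0 t0 tk b'0.
Qed.

End Play.

Lemma Ystar_Positive1 :
  [set s | s \in Ystar G r] `<=` Positive1 G (at_least G (LimInfAvg R r) 1).
Proof.
move=> s sY; exists optimist => sigma2; apply: (@optimist_wins s sigma2 [::] s) => //.
  by rewrite /cylinder_prob big_ord0 oner_neq0.
by rewrite state_prob_nil eqxx ltr01.
Qed.

End Player1.

Theorem theorem15 (R : realType) :
  (forall (S A : finType) (G : game R S A) (r : S -> A -> A -> bool),
    let Y : set S := [set s | s \in Ystar G r] in
    [/\ Y = Positive1 G (at_least G (LimInfAvg R r) 1),
        Y = Positive1 G (at_least G (LimSupAvg R r) 1),
        Y = \bigcap_(e in [set e : R | 0 < e])
              Positive1 G (at_least G (LimInfAvg R r) (1 - e))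
      & Y = \bigcap_(e in [set e : R | 0 < e])
              Positive1 G (at_least G (LimSupAvg R r) (1 - e))]
    /\
    [/\ ~` Y = Almost2 G (less_than G (LimInfAvg R r) 1),
        ~` Y = Almost2 G (less_than G (LimSupAvg R r) 1),
        ~` Y = \bigcup_(c in [set c : R | 0 < c])
                 Almost2 G (less_than G (LimInfAvg R r) (1 - c))
      & ~` Y = \bigcup_(c in [set c : R | 0 < c])
                 Almost2 G (less_than G (LimSupAvg R r) (1 - c))])
  /\
  (exists (nu : cmd) (C : nat),
    forall (S A : finType) (G : game R S A) (r : S -> A -> A -> bool),
      (forall (Y : {set S}) (m : memory), encodes G r Y m ->
         exists (t : nat) (m' : memory),
           run nu m t m' /\ encodes G r (nuZ G r Y) m') /\
      (exists (t : nat) (m' : memory),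
         [/\ run (mu_loop nu) (input G r) t m',
             encodes G r (Ystar G r) m'
           & (t <= C * (#|S| * delta_size G).+1)%N])).
Proof.
split; last exact: Ystar_quadratic_time.
move=> S A G r Y; apply: determinacy_from_inclusions.
  exact: Ystar_Positive1.
exact: Almost2_outside_Ystar.
Qed.
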